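(* Assume that $S_n/a_n$ under $\mathbb{P}$ converges in law, as $n\to\infty$, to $X_1$ under $\mathbf{P}^{[\alpha,\rho]}$, with $\rho\in(0,1)$. Let $N\in\mathbb{N}$, $x\ge 0$, and let $\mu=\inf\{t: X_t=\inf_{s\ge 0}X_s\}$. Then under $\mathbf{P}_x^{+,N}$ the post-minimum process $\{X_{t+\mu}-\inf_{s\ge0}X_s,\ t\ge 0\}$ has law $\mathbf{P}_0^{+,N}$, and the overall minimum $\inf_{s\ge0}X_s$ is distributed as $$\mathbf{P}_x^{+,N}\Big(\inf_{s\ge 0}X_s\ge z\Big)=\frac{V_N(x-z)}{V_N(x)},\qquad 0\le z\le x.$$ Moreover, under $\mathbf{P}_x^{+,N}$ the pre-minimum process $\{X_s,\ s\le\mu\}$ and the post-minimum process are independent.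
   Context: Random walk. Let $\Omega_{\mathrm{RW}}=\mathbb{R}^{\mathbb{Z}^+}$, $\mathbb{Z}^+=\{0,1,\dots\}$, with coordinate process $S=\{S_n\}_{n\ge 0}$. For $x\in\mathbb{R}$, $\mathbb{P}_x$ is the law on $\Omega_{\mathrm{RW}}$ of a random walk started at $x$: $\mathbb{P}_x(S_0=x)=1$ and the increments $S_n-S_{n-1}$, $n\ge1$, are i.i.d. with a fixed law not depending on $x$; $\mathbb{P}=\mathbb{P}_0$. $(a_n)$ is a sequence of positive real numbers. $X=\{X_t\}_{t\ge 0}$ is the coordinate process on $\Omega=D([0,\infty),\mathbb{R})$ (càdlàg paths, Skorohod topology). $\mathbf{P}^{[\alpha,\rho]}$ is the law on $\Omega$ of a (strictly) stable Lévy process started at $0$, of index $\alpha\in(0,2]$ and positivity parameter $\rho=\mathbf{P}^{[\alpha,\rho]}(X_1\ge 0)$. Under the hypothesis the walk oscillates: $\limsup_k S_k=+\infty$, $\liminf_k S_k=-\infty$, $\mathbb{P}$-a.s. Set $\overline{T}_0=0$, $\overline{H}_0=0$, $\overline{T}_{k+1}=\min\{j>\overline{T}_k: -S_j>\overline{H}_k\}$, $\overline{H}_k=-S_{\overline{T}_k}$ (strict descending ladder process), and $V(y)=\sum_{k\ge 0}\mathbb{P}(\overline{H}_k\le y)$ for $y\ge 0$. Let $\mathcal{C}_N=\{S_1\ge0,\dots,S_N\ge 0\}$ and $V_N(x)=\mathbb{P}(\mathcal{C}_N)\,V(a_Nx)$ for $x\ge 0$. For $y\ge 0$, $\mathbb{P}_y^+$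 is the law on $\Omega_{\mathrm{RW}}$ of the Markov chain started at $y$ defined by $$\mathbb{P}_y^+(B)=\frac{1}{V(y)}\mathbb{E}_y\big(V(S_N)\mathbf{1}_B\mathbf{1}_{\mathcal{C}_N}\big),\qquad N\in\mathbb{N},\ B\in\sigma(S_1,\dots,S_N).$$ $\phi_N:\Omega_{\mathrm{RW}}\to\Omega$ is given by $(\phi_N(\xi))(t)=\xi_{\lfloor Nt\rfloor}/a_N$, $t\ge 0$, and for $x\ge 0$, $\mathbf{P}_x^{+,N}=\mathbb{P}^+_{a_Nx}\circ\phi_N^{-1}$. *)

(* Defs.v *)
From HB Require Import structures.
From mathcomp Require Import all_boot all_order all_algebra.
From mathcomp Require Import all_classical all_reals all_analysis.
From mathcomp Require Import measurable_realfun.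
From mathcomp Require Import lra.

Set Implicit Arguments.
Unset Strict Implicit.
Unset Printing Implicit Defensive.

Import Order.TTheory GRing.Theory Num.Theory.
Import numFieldNormedType.Exports.

Local Open Scope classical_set_scope.
Local Open Scope ring_scope.

Definition RW_sets (R : realType) (I : set nat) : set (set (nat -> R)) :=
  \bigcup_(n in I) preimage_set_system setT (fun w => w n) measurable.

Definition Omega_RW (R : realType) := g_sigma_algebraType (@RW_sets R setT).

Definition S_ (R : realType) (n : nat) (w : Omega_RW R) : R := w n.

Definition sigma_S (R : realType) (N : nat) : set (set (Omega_RW R)) :=
  <<s @RW_sets R [set n | (1 <= n <= N)%N] >>.

Definition cadlag (R : realType) (f : R -> R) : Prop :=
  (forall t, 0 <= t -> f s @[s --> t^'+] --> f t) /\
  (forall t, 0 < t -> cvg (f s @[s --> t^'-])).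

(* A path on [0, +oo[ is encoded as a function on R that takes the value f 0 at
   negative times, so that distinct elements of [cadlag_path R] are distinct paths. *)
Record cadlag_path (R : realType) := CadlagPath {
  path :> R -> R ;
  path_cadlag : cadlag path ;
  path_neg : forall t, t < 0 -> path t = path 0 }.

Lemma cst0_cadlag (R : realType) : cadlag (fun _ : R => 0 : R).
Proof. by split=> t _; [exact: cvg_cst|exact: is_cvg_cst]. Qed.

HB.instance Definition _ (R : realType) := gen_eqMixin (cadlag_path R).
HB.instance Definition _ (R : realType) := gen_choiceMixin (cadlag_path R).
HB.instance Definition _ (R : realType) :=
  isPointed.Build (cadlag_path R) (CadlagPath (@cst0_cadlag R) (fun _ _ => erefl)).

Definition cadlag_sets (R : realType) : set (set (cadlag_path R)) :=
  \bigcup_(t in [set t : R | 0 <= t])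
    preimage_set_system setT (fun w : cadlag_path R => w t) measurable.

(* The Borel sigma-algebra of the Skorohod topology is the one generated by the
   coordinates. *)
Definition Omega (R : realType) := g_sigma_algebraType (@cadlag_sets R).

Definition X_ (R : realType) (t : R) (w : Omega R) : R := (w : cadlag_path R) t.

Section affine_path.
Variables (R : realType) (f : cadlag_path R) (c m k b : R).
Hypotheses (c0 : 0 < c) (m0 : 0 <= m).

Definition affine_fun (t : R) : R := k * f (c * Num.max t 0 + m) - b.

Lemma affine_cadlag : cadlag affine_fun.
Proof.
have [rc ll] := path_cadlag f; split=> t t0; rewrite /affine_fun.
- apply: cvgB; last exact: cvg_cst.
  apply: cvgM; first exact: cvg_cst.
  rewrite (max_idPl t0).
  have /rc : 0 <= c * t + m by rewrite addr_ge0// mulr_ge0// ltW.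
  move/cvgrPdist_lt => H; apply/cvgrPdist_lt => e e0.
  have := H e e0; rewrite !near_withinE => -[d /= d0 Hd].
  exists (d / c); first by rewrite /= divr_gt0.
  move=> s /= ts st; have s0 : 0 <= s by rewrite (le_trans t0) ?ltW.
  rewrite (max_idPl s0); apply: Hd => /=; last by rewrite ltrD2r ltr_pM2l.
  rewrite opprD addrACA subrr addr0 -mulrBr normrM gtr0_norm//.
  by rewrite mulrC -ltr_pdivlMr.
- have /ll/cvg_ex[l /= fl] : 0 < c * t + m by rewrite ltr_pwDl// mulr_gt0.
  apply/cvg_ex; exists (k * l - b).
  apply: cvgB; last exact: cvg_cst.
  apply: cvgM; first exact: cvg_cst.
  move/cvgrPdist_lt : fl => H; apply/cvgrPdist_lt => e e0.
  have := H e e0; rewrite !near_withinE => -[d /= d0 Hd].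
  exists (Num.min t (d / c)); first by rewrite /= lt_min t0 divr_gt0.
  move=> s /=; rewrite lt_min => /andP[ts1 ts] st.
  have s0 : 0 <= s by move: ts1; rewrite ltr_norml => /andP[_]; lra.
  rewrite (max_idPl s0); apply: Hd => /=; last by rewrite ltrD2r ltr_pM2l.
  rewrite opprD addrACA subrr addr0 -mulrBr normrM gtr0_norm//.
  by rewrite mulrC -ltr_pdivlMr.
Qed.

Lemma affine_neg t : t < 0 -> affine_fun t = affine_fun 0.
Proof. by move=> t0; rewrite /affine_fun maxxx (max_idPr (ltW t0)). Qed.

Definition affine_path : cadlag_path R := CadlagPath affine_cadlag affine_neg.

End affine_path.

Section phi.
Variables (R : realType) (a : nat -> R) (N : nat).

(* [Num.truncn] is the floor on [0, +oo[ and 0 at negative arguments. *)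
Definition phi_fun (w : Omega_RW R) (t : R) : R :=
  S_ (Num.truncn (N%:R * t)) w / a N.

Lemma phi_cadlag w : cadlag (phi_fun w).
Proof.
have [N0|N0] := posnP N.
  have -> : phi_fun w = fun=> S_ 0 w / a N.
    by apply/funext => t; rewrite /phi_fun N0 mul0r truncn0.
  by split=> t _; [exact: cvg_cst|exact: is_cvg_cst].
have c0 : 0 < N%:R :> R by rewrite ltr0n.
split=> t t0; rewrite /phi_fun.
- apply: cvg_near_cst; rewrite near_withinE.
  set k := Num.truncn (N%:R * t).
  have /andP[kt tk] : k%:R <= N%:R * t < k.+1%:R.
    by apply: truncn_itv; rewrite mulr_ge0// ltW.
  exists (k.+1%:R / N%:R - t) => /=; first by rewrite subr_gt0 ltr_pdivlMr// mulrC.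
  move=> s /= ts st; have -> // : Num.truncn (N%:R * s) = k.
  apply: truncn_def; rewrite (le_trans kt) ?ler_pM2l ?ltW//=.
  rewrite mulrC -ltr_pdivlMr//; move: ts; rewrite ltr_norml => /andP[+ _].
  set u := _ / _; lra.
- have [m /andP[mt tm]] : exists m, (m%:R : R) < N%:R * t <= m.+1%:R.
    have /truncn_itv/andP[] : 0 <= N%:R * t by rewrite mulr_ge0// ltW.
    set k := Num.truncn _; rewrite le_eqVlt => /orP[/eqP kt|kt tk]; last first.
      by exists k; rewrite kt ltW.
    case: k kt => [kt|k kt _]; first by move: (mulr_gt0 c0 t0); rewrite -kt ltxx.
    by exists k; rewrite -kt lexx ltr_nat ltnSn.
  apply/cvg_ex; exists (S_ m w / a N).
  apply: cvg_near_cst; rewrite near_withinE.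
  exists (t - m%:R / N%:R) => /=; first by rewrite subr_gt0 ltr_pdivrMr// mulrC.
  move=> s /= ts st; have -> // : Num.truncn (N%:R * s) = m.
  apply: truncn_def; apply/andP; split; last first.
    by apply: lt_le_trans tm; rewrite ltr_pM2l.
  rewrite mulrC -ler_pdivrMr//; move: ts; rewrite ltr_norml => /andP[_].
  set u := _ / _; lra.
Qed.

Lemma phi_neg w t : t < 0 -> phi_fun w t = phi_fun w 0.
Proof.
move=> t0; rewrite /phi_fun mulr0 truncn0.
suff -> : Num.truncn (N%:R * t) = 0%N by [].
rewrite truncn_floor; case: ifPn => // Nt.
have -> : N%:R * t = 0; last by rewrite floor0.
by apply/le_anti; rewrite Nt andbT mulr_ge0_le0// ltW.
Qed.

Definition phi (w : Omega_RW R) : Omega R := CadlagPath (@phi_cadlag w) (@phi_neg w).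

Lemma measurable_S n : measurable_fun setT (@S_ R n).
Proof.
move=> _ B mB; apply: sub_sigma_algebra; exists n => //; exists B => //.
Qed.

Lemma measurable_phi : measurable_fun setT phi.
Proof.
apply: (@measurability _ _ _ _ setT phi (@cadlag_sets R)) => //.
move=> _ [_ [t t0 [B mB <-]] <-]; rewrite !setTI.
have mF : measurable_fun setT
    (fun w : Omega_RW R => S_ (Num.truncn (N%:R * t)) w / a N).
  exact: (measurableT_comp (mulrr_measurable (a N)^-1) (measurable_S _)).
by rewrite -[X in measurable X]setTI; exact: mF.
Qed.

HB.instance Definition _ := isMeasurableFun.Build _ _ _ _ phi measurable_phi.

End phi.

Definition mutual_indep d (T : measurableType d) (R : realType)
    (P : probability T R) (Y : nat -> T -> R) : Prop :=
  forall (s : seq nat) (B : nat -> set R),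
    uniq s -> (forall i, measurable (B i)) ->
    (P (\bigcap_(i in [set` s]) (Y i @^-1` B i)) =
     \prod_(i <- s) P (Y i @^-1` B i))%E.

Definition cvg_in_law d d' (T : measurableType d) (T' : measurableType d')
    (R : realType) (P : probability T R) (Y : nat -> T -> R)
    (Q : probability T' R) (Z : T' -> R) : Prop :=
  forall f : R -> R, continuous f -> (exists M, forall r, `|f r| <= M) ->
    (\int[P]_w (f (Y n w))%:E @[n --> \oo] --> \int[Q]_w (f (Z w))%:E)%E.

Definition is_random_walk (R : realType) (nu : probability R R) (x : R)
    (P : probability (Omega_RW R) R) : Prop :=
  [/\ P [set w | S_ 0 w = x] = 1%E,
      forall n (B : set R), measurable B ->
        P [set w | B (S_ n.+1 w - S_ n w)] = nu B &
      mutual_indep P (fun n w => S_ n.+1 w - S_ n w)].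

Definition first_index (p : pred nat) : option nat :=
  if pselect (exists n, p n) is left h then Some (ex_minn h) else None.

(* The pair of the k-th strict descending ladder epoch and ladder height;
   [None] when the epoch is the minimum of an empty set, i.e. infinite. *)
Fixpoint ladder (R : realType) (w : Omega_RW R) (k : nat) : option (nat * R) :=
  if k is k'.+1 then
    if ladder w k' is Some (m, h) then
      omap (fun j => (j, - S_ j w))
           (first_index (fun j => (m < j)%N && (h < - S_ j w)))
    else None
  else Some (0%N, 0).

Definition ladder_height (R : realType) (k : nat) (w : Omega_RW R) : \bar R :=
  if ladder w k is Some (_, h) then h%:E else +oo%E.

Definition renewal (R : realType) (P0 : probability (Omega_RW R) R) (y : R) : \bar R :=
  (\sum_(0 <= k <oo) P0 [set w | ladder_height k w <= y%:E])%E.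

Definition stays_nonneg (R : realType) (N : nat) : set (Omega_RW R) :=
  [set w | forall n, (1 <= n <= N)%N -> 0 <= S_ n w].

Definition VN (R : realType) (P0 : probability (Omega_RW R) R) (a : nat -> R)
    (N : nat) (x : R) : \bar R :=
  (P0 (@stays_nonneg R N) * renewal P0 (a N * x))%E.

(* [P] is the whole family of walk laws; the renewal function is that of P 0. *)
Definition is_conditioned_walk (R : realType)
    (P : R -> probability (Omega_RW R) R) (y : R)
    (Py : probability (Omega_RW R) R) : Prop :=
  Py [set w | S_ 0 w = y] = 1%E /\
  forall N (B : set (Omega_RW R)), (0 < N)%N -> sigma_S N B ->
    (Py B = (renewal (P 0%R) y)^-1 *
            \int[P y]_(w in B `&` @stays_nonneg R N) renewal (P 0%R) (S_ N w))%E.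

(* The map sending a path w to the path t |-> c `^ (- alpha^-1) * w (c * t). *)
Definition rescale (R : realType) (alpha : R) (c : {posnum R}) (w : Omega R) :
    Omega R :=
  affine_path w (c%:num `^ (- alpha^-1)) 0 (gt0 c) (lexx 0).

Definition is_levy (R : realType) (Q : probability (Omega R) R) : Prop :=
  [/\ Q [set w | X_ 0 w = 0] = 1%E,
      forall t : nat -> R, 0 <= t 0%N -> nondecreasing_seq t ->
        mutual_indep Q (fun i w => X_ (t i.+1) w - X_ (t i) w) &
      forall s t (B : set R), 0 <= s -> 0 <= t -> measurable B ->
        Q [set w | B (X_ (s + t) w - X_ s w)] = Q [set w | B (X_ t w)]].

Definition is_stable_levy (R : realType) (alpha rho : R)
    (Q : probability (Omega R) R) : Prop :=
  [/\ 0 < alpha <= 2,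
      is_levy Q,
      forall (c : {posnum R}) (A : set (Omega R)), measurable A ->
        pushforward Q (rescale alpha c) A = Q A &
      Q [set w | 0 <= X_ 1 w] = rho%:E].

(* Conventions of [inf]: infX is 0 for a path unbounded below, argmin_time is 0
   for a path that does not attain infX. *)
Definition infX (R : realType) (w : Omega R) : R :=
  inf [set X_ t w | t in [set t : R | 0 <= t]].

Definition argmin_time (R : realType) (w : Omega R) : R :=
  inf [set t : R | 0 <= t /\ X_ t w = infX w].

Lemma argmin_time_ge0 (R : realType) (w : Omega R) : 0 <= argmin_time w.
Proof.
rewrite /argmin_time; set A := [set _ | _].
have [->|/set0P A0] := eqVneq A set0; first by rewrite inf0.
by apply: lb_le_inf => // t [].
Qed.

(* The path t |-> X_(t + mu) - inf X. *)
Definition post_min (R : realType) (w : Omega R) : Omega R :=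
  affine_path w 1 (infX w) ltr01 (argmin_time_ge0 w).

(* The sigma-algebra of {X_s, s <= mu}, mu = argmin_time, seen as a process
   that is sent to a cemetery state after time mu; with B = setT it contains
   the events {t <= mu}. Such sets, like preimages by [post_min], need not be
   measurable in [Omega], but their preimages by [phi] are measurable in
   [Omega_RW]. *)
Definition pre_min_sigma (R : realType) : set (set (Omega R)) :=
  <<s [set A | exists t (B : set R), [/\ 0 <= t, measurable B &
         A = [set w | t <= argmin_time w /\ B (X_ t w)]]] >>.

Definition PplusN (R : realType) (Pplus : R -> probability (Omega_RW R) R)
    (a : nat -> R) (N : nat) (x : R) : probability (Omega R) R :=
  distribution (Pplus (a N * x)) (phi a N).

(* Main.v *)
Require Import Defs.
From mathcomp Require Import all_boot all_order all_algebra.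
From mathcomp Require Import all_classical all_reals all_analysis.
From mathcomp Require Import measurable_realfun zify lra ring.

(** Write V for the renewal function, P_y for the walk, P_y^+ for the
    conditioned walk, and theta_k w for the path n |-> w (k + n) - w k.  Let
    E_k be the event that the walk has a nonnegative overall minimum, reached for
    the first time at k, and L_k the event that S_k >= 0 is a strict minimum of
    S_0, ..., S_k.  Everything follows from one product formula
    ([Pplus_min_at_restart]): for A determined by S_0, ..., S_k,

      P_y^+(A, E_k, theta_k in C) = V(y)^-1 P_y(A, L_k) P_0^+(C).

    Its proof is a mass count.  The inequality >= is direct ([weight_le],
    [weight_le_min_at]): P_y^+ is P_y reweighted by V(S_(k+M)) / V(y) on
    paths that stay nonnegative, on L_k one has
    V(S_(k+M)) >= V(S_(k+M) - S_k), and under P_y the path theta_k is a walk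
    from 0 independent of S_0, ..., S_k ([restart_independent]); the remaining
    expectation is V(0) P_0^+(C), with V(0) = 1.  For the converse, the right
    hand sides with A and C full have total mass
    V(y)^-1 \sum_k P_y(L_k).  Up to a translation by y, L_k says that k is a
    strict descending ladder epoch with height at most y, so summing over k
    counts the ladder heights in [0, y] and the sum is V(y)
    ([renewal_strict_min], [series_weight]).  Thus masses with sum one
    are lower bounds for the probabilities of disjoint events: there is no slack,
    all the inequalities are equalities, and the minimum is almost surely
    attained.
    The function V is finite because P_y^+ has total mass one.

    Summing the product formula over k gives the law P_0^+ of theta at the
    minimum and its independence from the past; with A = {S_k >= z} the sum is
    the renewal function at y - z, whence the law of the minimum.  The last
    part reads these statements through the rescaling map, whose paths are step
    functions: the first time of the minimum is a grid point k / N, and the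
    post-minimum path is the rescaling of theta_k. *)

Set Implicit Arguments.
Unset Strict Implicit.
Unset Printing Implicit Defensive.

Import Order.TTheory GRing.Theory Num.Theory.
Import numFieldNormedType.Exports.
Local Open Scope classical_set_scope.
Local Open Scope ring_scope.

(** * Coordinate sigma-algebras on the space of trajectories *)

Section coordinates.
Variable R : realType.
Implicit Types (I J : set nat).

(** All these sigma-algebras share the carrier of [Omega_RW], so that events
    are compared across them without transport. *)
Definition coord_space (I : set nat) := g_sigma_algebraType (@RW_sets R I).

Lemma measurable_coord I j : I j ->
  measurable_fun [set: coord_space I] (fun w : coord_space I => (w : nat -> R) j).
Proof.
by move=> Ij _ B mB; apply: sub_sigma_algebra; exists j => //; exists B.
Qed.

Lemma measurable_to_coord d (T : measurableType d) J (f : T -> coord_space J) :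
  (forall j, J j -> measurable_fun setT (fun w => (f w : nat -> R) j)) ->
  measurable_fun setT f.
Proof.
move=> mf; apply: (@measurability _ _ _ _ setT f (@RW_sets R J)) => //.
move=> _ [_ [j Jj [B mB <-]] <-]; rewrite !setTI.
by rewrite -[X in measurable X]setTI; exact: mf.
Qed.

Lemma coord_space_mono I J (A : set (nat -> R)) : I `<=` J ->
  @measurable _ (coord_space I) A -> @measurable _ (coord_space J) A.
Proof.
move=> IJ mA.
have /(_ measurableT _ mA) : measurable_fun [set: coord_space J]
    (fun w : coord_space J => w : coord_space I).
  by apply: measurable_to_coord => j Ij; apply: measurable_coord; exact: IJ.
by rewrite setTI.
Qed.

Lemma measurable_lt d (T : measurableType d) (f g : T -> R) :
  measurable_fun setT f -> measurable_fun setT g ->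
  measurable [set x | f x < g x].
Proof.
move=> mf mg; rewrite -[X in measurable X]setTI.
have := @measurable_fun_ltr _ _ _ _ _ _ mf mg measurableT [set true]; exact.
Qed.

Lemma measurable_le d (T : measurableType d) (f g : T -> R) :
  measurable_fun setT f -> measurable_fun setT g ->
  measurable [set x | f x <= g x].
Proof.
move=> mf mg; rewrite -[X in measurable X]setTI.
have := @measurable_fun_ler _ _ _ _ _ _ mf mg measurableT [set true]; exact.
Qed.

Lemma measurable_eq d (T : measurableType d) (f g : T -> R) :
  measurable_fun setT f -> measurable_fun setT g ->
  measurable [set x | f x = g x].
Proof.
move=> mf mg; rewrite [X in measurable X](_ : _ =
  [set x | f x <= g x] `&` [set x | g x <= f x]).
  by apply: measurableI; exact: measurable_le.
apply/seteqP; split=> t /=; first by move=> ->.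
by case=> h1 h2; apply/le_anti/andP.
Qed.

Definition past (k : nat) : set nat := [set n | (n <= k)%N].

Definition history (k : nat) : set (set (Omega_RW R)) :=
  @measurable _ (coord_space (past k)).

Lemma history_mono k m A : (k <= m)%N -> history k A -> history m A.
Proof. by move=> km; apply: coord_space_mono => n /= /leq_trans; exact. Qed.

Lemma measurable_history k (A : set (Omega_RW R)) : history k A -> measurable A.
Proof. exact: coord_space_mono. Qed.

(** The path after time k, recentred at its value at time k. *)
Definition restart (k : nat) (w : Omega_RW R) : Omega_RW R :=
  fun n => w (k + n)%N - w k.

Lemma measurable_restart_coord I J k : I k -> (forall j, J j -> I (k + j)%N) ->
  measurable_fun setT (restart k : coord_space I -> coord_space J).
Proof.
move=> Ik IJ; apply: measurable_to_coord => j Jj.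
by apply: measurable_funB; apply: measurable_coord; auto.
Qed.

Lemma measurable_restart k : measurable_fun setT (restart k).
Proof. exact: (@measurable_restart_coord setT setT). Qed.

Lemma history_restart k m C : history m C -> history (k + m) (restart k @^-1` C).
Proof.
move=> mC; rewrite /history -[X in measurable X]setTI.
apply: (@measurable_restart_coord _ (past m)) => //=; first exact: leq_addr.
by move=> j; rewrite /past/= leq_add2l.
Qed.

Lemma measurable_preimage_restart k (C : set (Omega_RW R)) : measurable C ->
  measurable (restart k @^-1` C).
Proof.
by move=> mC; rewrite -[X in measurable X]setTI; exact: measurable_restart.
Qed.

Definition strict_min (k : nat) : set (Omega_RW R) :=
  [set w | forall j, (j < k)%N -> w k < w j].

Lemma history_strict_min k : history k (strict_min k).
Proof.
rewrite /history (_ : strict_min k = \bigcap_(j in [set j | (j < k)%N])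
    [set w : coord_space (past k) | (w : nat -> R) k < (w : nat -> R) j]); last first.
  by apply/seteqP; split=> w h j; exact: h.
apply: bigcap_measurableType => j /= jk.
apply: (@measurable_lt _ (coord_space (past k)));
  apply: measurable_coord; [exact: leqnn|exact: ltnW].
Qed.

Definition nonneg_strict_min (k : nat) : set (Omega_RW R) :=
  strict_min k `&` [set w | 0 <= w k].

Lemma history_level k (z : R) : history k [set w | z <= w k].
Proof.
by apply: (@measurable_le _ (coord_space (past k)) (fun=> z)
  (fun w : coord_space (past k) => (w : nat -> R) k)); last exact: measurable_coord (leqnn k).
Qed.

Lemma measurable_strict_min_ge k (z : R) :
  measurable (strict_min k `&` [set w | z <= w k]).
Proof.
apply: measurableI; first exact: measurable_history (@history_strict_min k).
exact: measurable_history (@history_level k z).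
Qed.

Lemma history_nonneg_strict_min k : history k (nonneg_strict_min k).
Proof.
by apply: measurableI; [exact: history_strict_min|exact: history_level].
Qed.

Lemma sigma_S_stays_nonneg N : sigma_S N (@stays_nonneg R N).
Proof.
set I := [set n | (1 <= n <= N)%N].
suff : @measurable _ (coord_space I) (@stays_nonneg R N) by [].
rewrite (_ : @stays_nonneg R N = \bigcap_n
    (if (1 <= n <= N)%N then [set w : coord_space I | 0 <= (w : nat -> R) n]
     else setT)); last first.
  apply/seteqP; split=> w h n.
    by move=> _; case: ifPn => //; exact: h.
  by move=> nN; have := h n Logic.I; rewrite nN.
apply: bigcapT_measurable => n; case: ifPn => // nN.
by apply: measurable_le => //; exact: measurable_coord.
Qed.

Lemma history_sigma_S N (A : set (Omega_RW R)) : sigma_S N A -> history N A.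
Proof. by apply: coord_space_mono => n /andP[_ ?]; exact. Qed.

Lemma history_stays_nonneg N : history N (@stays_nonneg R N).
Proof. apply: history_sigma_S. exact: sigma_S_stays_nonneg. Qed.

End coordinates.


(** * Increments, cylinders and the Markov property *)

Section cylinders.
Variable R : realType.

(** The starting point counts as increment number 0: the increments up to k then
    determine the path up to k, and under the law of a walk they are independent,
    the first one being deterministic. *)
Definition increment (i : nat) (w : Omega_RW R) : R :=
  if i is i'.+1 then w i'.+1 - w i' else w 0%N.

Definition cylinder (n : nat) (B : nat -> set R) : set (Omega_RW R) :=
  [set w | forall i, (i <= n)%N -> B i (increment i w)].

Definition cylinders (n : nat) : set (set (Omega_RW R)) :=
  [set cylinder n B | B in [set B : nat -> set R | forall i, measurable (B i)]].

Lemma sum_increment n (w : Omega_RW R) : w n = \sum_(i < n.+1) increment i w.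
Proof.
elim: n => [|n IH]; first by rewrite big_ord1.
by rewrite big_ord_recr /= -IH addrC subrK.
Qed.

Lemma history_increment n i : (i <= n)%N ->
  measurable_fun setT (increment i : coord_space R (past n) -> R).
Proof.
case: i => [|i] iN; first exact: measurable_coord iN.
by apply: measurable_funB; apply: measurable_coord => //; exact: ltnW.
Qed.

Lemma history_cylinder n (B : nat -> set R) : (forall i, measurable (B i)) ->
  history n (cylinder n B).
Proof.
move=> mB; rewrite /history (_ : cylinder n B =
  \bigcap_(i in [set i | (i <= n)%N]) (increment i @^-1` B i)); last first.
  by apply/seteqP; split=> w h i; exact: h.
apply: bigcap_measurableType => i /= iN.
by rewrite -[X in measurable X]setTI; exact: history_increment.
Qed.

Lemma cylindersI n : setI_closed (cylinders n).
Proof.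
move=> _ _ [B mB <-] [B' mB' <-]; exists (fun i => B i `&` B' i).
  by move=> i; exact: measurableI.
apply/seteqP; split=> w /=.
  by move=> h; split=> i /h[].
by move=> [h h'] i iN; split; [exact: h|exact: h'].
Qed.

Lemma cylindersT n : cylinders n setT.
Proof. by exists (fun=> setT) => //; apply/seteqP; split. Qed.

(** Each coordinate is a sum of increments, so the cylinders, which are stable
    under intersection, generate the history. *)
Lemma sub_history_cylinders n : history n `<=` <<s cylinders n >>.
Proof.
move=> A mA.
suff /(_ measurableT _ mA) : measurable_fun
    [set: g_sigma_algebraType (cylinders n)]
    (fun w : g_sigma_algebraType (cylinders n) => (w : coord_space R (past n))).
  by rewrite setTI.
apply: measurable_to_coord => j jn.
rewrite (_ : (fun _ => _) = (fun w => \sum_(i < j.+1) increment i w)); last first.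
  by apply/funext => w; exact: sum_increment.
apply: measurable_sum => -[i /=]; rewrite ltnS => ij _ B mB; rewrite setTI.
apply: sub_sigma_algebra.
exists (fun l => if l == i then B else setT).
  by move=> l /=; case: ifP.
apply/seteqP; split=> w /=.
  by move=> /(_ i); rewrite eqxx; apply; rewrite (leq_trans ij).
by move=> Bw l ln; case: eqP => // ->.
Qed.

Lemma measure_eq_cylinder n (m1 m2 : {measure set (Omega_RW R) -> \bar R}) :
  (m1 setT < +oo)%E -> (forall A, cylinders n A -> m1 A = m2 A) ->
  forall A, history n A -> m1 A = m2 A.
Proof.
move=> moo mE A /sub_history_cylinders.
apply: (@g_sigma_algebra_measure_unique _ _ _ (cylinders n) _ (fun=> setT)) => //.
- by move=> _ [B mB <-]; exact: measurable_history (history_cylinder mB).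
- by move=> _; exact: cylindersT.
- by rewrite bigcup_const//; exists 0%N.
- exact: cylindersI.
Qed.

Lemma measure_eq_history (m1 m2 : {measure set (Omega_RW R) -> \bar R}) :
  (m1 setT < +oo)%E -> (forall n A, history n A -> m1 A = m2 A) ->
  forall A, measurable A -> m1 A = m2 A.
Proof.
move=> moo mE A mA.
apply: (@g_sigma_algebra_measure_unique _ _ _
  (\bigcup_n @history R n) _ (fun=> setT)) => //.
- by move=> B [n _]; exact: measurable_history.
- by move=> _; exists 0%N => //; exact: (@measurableT _ (coord_space R (past 0))).
- by rewrite bigcup_const//; exists 0%N.
- move=> B C [n _ mB] [m _ mC]; exists (maxn n m) => //.
  apply: (@measurableI _ (coord_space R (past (maxn n m)))).
    exact: history_mono (leq_maxl _ _) mB.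
  exact: history_mono (leq_maxr _ _) mC.
- by move=> B [n _]; exact: mE.
- move: mA; apply: smallest_sub; first exact: smallest_sigma_algebra.
  move=> B [n _ [C mC <-]]; apply: sub_sigma_algebra; exists n => //.
  by apply: sub_sigma_algebra; exists n; [exact: leqnn|exists C].
Qed.

End cylinders.

Section full_sets.
Variables (d : measure_display) (T : measurableType d) (R : realType).
Variable (P : probability T R).

Lemma probability_setC0 (E : set T) : measurable E -> P E = 1%E ->
  P (~` E) = 0%E.
Proof. by move=> mE PE; rewrite probability_setC// PE subee. Qed.

Lemma probability_setI1 (A E : set T) : measurable A -> measurable E ->
  P E = 1%E -> P (A `&` E) = P A.
Proof.
move=> mA mE PE; have E0 := probability_setC0 mE PE.
rewrite [RHS](measureDI P mA mE).
rewrite [X in (X + _)%E](_ : _ = 0%E) ?add0e//.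
apply/eqP; rewrite eq_le measure_ge0 andbT -E0; apply: le_measure.
- by rewrite inE; exact: measurableD.
- by rewrite inE; exact: measurableC.
- by move=> w [].
Qed.

End full_sets.

Section restart_law.
Variables (R : realType) (nu : probability R R).
Implicit Types (y : R) (P : probability (Omega_RW R) R).

Lemma random_walk_cylinder y P n (B : nat -> set R) : is_random_walk nu y P ->
  (forall i, measurable (B i)) ->
  P (cylinder n B) = (\d_y (B 0%N) * \prod_(i < n) nu (B i.+1))%E.
Proof.
move=> [P0 Pi Pind] mB.
have m0 : measurable [set w : Omega_RW R | S_ 0 w = y].
  by apply: measurable_eq => //; exact: measurable_S.
set K := \bigcap_(i in [set` iota 0 n]) ((fun w : Omega_RW R => S_ i.+1 w - S_ i w) @^-1` B i.+1).
have PK : P K = (\prod_(i < n) nu (B i.+1))%E.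
  rewrite /K (Pind (iota 0 n) (fun i => B i.+1)) ?iota_uniq//.
  by rewrite -[n in iota 0 n]subn0 big_mkord; apply: eq_bigr => i _; exact: Pi.
have mK : measurable K.
  apply: bigcap_measurableType => i _; rewrite -[X in measurable X]setTI.
  by apply: measurable_funB => //; exact: measurable_S.
rewrite -(@probability_setI1 _ _ _ P _ _ _ m0 P0); last first.
  exact: measurable_history (history_cylinder mB).
have cylE : cylinder n B `&` [set w | S_ 0 w = y] =
    if y \in B 0%N then K `&` [set w | S_ 0 w = y] else set0.
  case: ifPn => [|]; rewrite ?inE ?notin_setE => By; apply/seteqP; split=> w //=.
  - move=> [h wy]; split=> // i /=; rewrite mem_iota add0n => iN.
    exact: (h i.+1).
  - move=> [h wy]; split=> // -[_|i iN]; first by rewrite /= -[w 0%N]/(S_ 0 w) wy.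
    by apply: h; rewrite /= mem_iota.
  - by move=> [/(_ 0%N isT) /=]; rewrite -[w 0%N]/(S_ 0 w) => + wy; rewrite wy.
rewrite cylE diracE; case: ifPn => _; last by rewrite measure0 mul0e.
by rewrite (@probability_setI1 _ _ _ P _ _ _ m0 P0)// PK mul1e.
Qed.

(** The restarted path has increments 0, then those of the original path after
    time k; hence the case distinction on 0, and the concatenation of the
    constraints of the two cylinders. *)
Lemma restart_cylinder k m (B C : nat -> set R) :
  cylinder k B `&` restart k @^-1` (cylinder m C) =
  if 0 \in C 0%N then
    cylinder (k + m) (fun i => if (i <= k)%N then B i else C (i - k)%N)
  else set0.
Proof.
have incr0 (w : Omega_RW R) : increment 0 (restart k w) = 0.
  by rewrite /= /restart addn0 subrr.
have incrS i (w : Omega_RW R) :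
    increment i.+1 (restart k w) = increment (k + i.+1)%N w.
  by rewrite /= /restart addnS /= opprB addrA subrK.
case: ifPn => [|]; rewrite ?inE ?notin_setE => C0; apply/seteqP; split=> w //=.
- move=> [Bw Cw] i ikm; case: (leqP i k) => ik; first exact: Bw.
  have [j ij] : exists j, i = (k + j.+1)%N by exists (i - k).-1; lia.
  by rewrite ij addKn -incrS; apply: Cw; lia.
- move=> h; split=> i ik.
    by have := h i; rewrite ik; apply; lia.
  case: i ik => [|i] ik; first by rewrite incr0.
  have := h (k + i.+1)%N; rewrite incrS addKn ifF; first by apply; lia.
  by lia.
- by move=> [_ /(_ 0%N isT)]; rewrite incr0.
Qed.

Lemma fine_probability P (D : set (Omega_RW R)) : measurable D ->
  (fine (P D))%:E = P D.
Proof. by move=> mD; rewrite fineK// fin_num_measure. Qed.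

Lemma fine_probability_ge0 P (D : set (Omega_RW R)) : 0 <= fine (P D).
Proof. exact: fine_ge0. Qed.

Definition probability_nng P (D : set (Omega_RW R)) : {nonneg R} :=
  NngNum (fine_probability_ge0 P D).

Lemma mscale_probabilityE P P' (D D' : set (Omega_RW R)) : measurable D ->
  mscale (probability_nng P D) P' D' = (P D * P' D')%E.
Proof. by move=> mD; rewrite -[in RHS](fine_probability P mD). Qed.

(** Packages the law of the restarted path on an event as a measure, to which
    uniqueness theorems apply. *)
Lemma restart_measure P k (A : set (Omega_RW R)) : measurable A ->
  exists m : {measure set (Omega_RW R) -> \bar R},
    (forall D, m D = P (A `&` restart k @^-1` D)) /\
    (forall D f, measurable D -> measurable_fun D f -> (forall w, 0 <= f w)%E ->
      (\int[m]_(w in D) f w =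
       \int[P]_(w in A `&` restart k @^-1` D) f (restart k w))%E).
Proof.
move=> mA; unshelve eexists (pushforward (mrestr P mA) (restart k)
  : {measure set (Omega_RW R) -> \bar R}); first exact: measurable_restart.
split=> [D|D f mD mf f0]; first by rewrite setIC.
have mE : measurable (restart k @^-1` D) by exact: measurable_preimage_restart.
have mg : measurable_fun (restart k @^-1` D) (fun w => f (restart k w)).
  apply: (@measurable_comp _ _ _ _ _ _ D) => //.
  - by move=> _ [w Dw <-].
  - by apply: measurable_funTS; exact: measurable_restart.
rewrite ge0_integral_pushforward//; last exact: measurable_restart.
rewrite (@ge0_negligible_integral _ _ _ _ _ (~` A))//=; first 1 last.
- exact: measurableC.
- by rewrite /mrestr setICl measure0.
rewrite setDE setCK setIC; apply: eq_measure_integral => B mB BA.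
by rewrite -[LHS]/(P (B `&` A)) setIidl// => w /BA[].
Qed.

(** The Markov property with independent increments.  On cylinders both sides
    are the same product of increment laws; uniqueness of finite measures
    extends the identity first in A, then in C. *)
Lemma restart_independent y P P0 k (A C : set (Omega_RW R)) :
  is_random_walk nu y P -> is_random_walk nu 0 P0 ->
  history k A -> measurable C ->
  P (A `&` restart k @^-1` C) = (P A * P0 C)%E.
Proof.
move=> walkP walkP0 hA.
have mA := measurable_history hA.
move: C.
have [m1 [m1E _]] := restart_measure P k mA.
have on_cylinders n (D : set (Omega_RW R)) : cylinders n D ->
    P (A `&` restart k @^-1` D) = (P A * P0 D)%E.
  move=> [C mC <-]; set D' := cylinder n C.
  have mD' : measurable D' by exact: measurable_history (history_cylinder mC).
  have := @measure_eq_cylinder R k (mrestr P (measurable_preimage_restart k mD'))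
     (mscale (probability_nng P0 D') P) _ _ A hA.
  rewrite /= mscale_probabilityE// muleC /mrestr; apply.
    rewrite setTI (le_lt_trans (probability_le1 _ _)) ?ltry//.
    exact: measurable_preimage_restart.
  move=> _ [B mB <-]; rewrite restart_cylinder /= mscale_probabilityE// muleC.
  rewrite (random_walk_cylinder _ walkP)// (random_walk_cylinder _ walkP0)//.
  rewrite !diracE; case: ifPn => _; last by rewrite measure0 mul0e mule0.
  rewrite mul1e (random_walk_cylinder _ walkP) ?diracE//=; last by move=> i; case: ifP.
  rewrite -muleA; congr (_ * _)%E.
  rewrite big_split_ord/=; congr (_ * _)%E; apply: eq_bigr => i _.
    by rewrite ltn_ord.
  by rewrite ifF ?subSn ?leq_addr// ?addKn//; lia.
have m1oo : (m1 setT < +oo)%E.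
  by rewrite m1E preimage_setT setIT (le_lt_trans (probability_le1 _ _)) ?ltry.
have m1_product D : measurable D -> m1 D = mscale (probability_nng P A) P0 D.
  apply: measure_eq_history => // n; apply: measure_eq_cylinder => // B cB.
  by rewrite m1E /= mscale_probabilityE//; exact: on_cylinders cB.
by move=> D mD; have := m1_product D mD; rewrite m1E mscale_probabilityE//.
Qed.

(** The same independence for a function of the restarted path, read as an
    integral against the image of P restricted to A, which is a multiple of P0. *)
Lemma restart_independent_integral y P P0 k (A D : set (Omega_RW R))
    (f : Omega_RW R -> \bar R) :
  is_random_walk nu y P -> is_random_walk nu 0 P0 -> history k A ->
  measurable D -> measurable_fun D f -> (forall w, 0 <= f w)%E ->
  (\int[P]_(w in A `&` restart k @^-1` D) f (restart k w) =
   P A * \int[P0]_(w in D) f w)%E.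
Proof.
move=> walkP walkP0 hA mD mf f0; have mA := measurable_history hA.
have [m [mE mI]] := restart_measure P k mA.
rewrite -mI// -[in RHS](fine_probability P mA).
rewrite -[in RHS](@ge0_integral_mscale _ _ _ _ _ mD (probability_nng P A))//.
apply: eq_measure_integral => B mB _.
rewrite [RHS]mscale_probabilityE// mE.
exact: restart_independent walkP walkP0 hA mB.
Qed.

End restart_law.


(** * Strict descending ladder epochs as records *)

Section ladder_process.
Variable R : realType.
Implicit Types (w : Omega_RW R).

(** At time 0 the height is 0 and not - w 0, as in the ladder process, whose
    initial height does not depend on the starting point. *)
Definition height (n : nat) w : R := if n is n'.+1 then - w n'.+1 else 0.

Definition record_at (n : nat) : set (Omega_RW R) :=
  [set w | forall j, (j < n)%N -> height j w < height n w].

(** Only times before n are counted, so that the k-th ladder epoch is the record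
    preceded by k others (time 0 is the record preceded by none). *)
Definition record_count (n : nat) w : nat := \sum_(j < n) `[< record_at j w >].

Lemma record_countS n w :
  record_count n.+1 w = (record_count n w + `[< record_at n w >])%N.
Proof. by rewrite /record_count big_ord_recr. Qed.

Lemma record_count_mono m n w : (m <= n)%N ->
  (record_count m w <= record_count n w)%N.
Proof.
elim: n => [|n IH]; first by rewrite leqn0 => /eqP ->.
rewrite leq_eqVlt => /orP[/eqP -> //|]; rewrite ltnS => /IH h.
by rewrite record_countS (leq_trans h)// leq_addr.
Qed.

Lemma record_count_lt m n w : record_at m w -> (m < n)%N ->
  (record_count m w < record_count n w)%N.
Proof.
move=> rm /(record_count_mono w); apply: leq_trans.
by rewrite record_countS asboolT// addn1.
Qed.

Lemma exists_record n c w : (c < record_count n w)%N ->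
  exists m, [/\ (m < n)%N, record_at m w & record_count m w = c].
Proof.
elim: n => [|n IH]; first by rewrite /record_count big_ord0.
rewrite record_countS; case: asboolP => rn; last first.
  by rewrite addn0 => /IH[m [mn rm cm]]; exists m; split => //; exact: ltnW.
rewrite addn1 ltnS leq_eqVlt => /orP[/eqP ->|/IH[m [mn rm cm]]].
  by exists n.
by exists m; split => //; exact: ltnW.
Qed.

Lemma first_indexP (p : pred nat) n : first_index p = Some n ->
  p n /\ forall j, p j -> (n <= j)%N.
Proof.
rewrite /first_index; case: pselect => // h [<-].
by case: ex_minnP => m pm mmin; split.
Qed.

Lemma first_index_exists (p : pred nat) n : p n ->
  exists j, first_index p = Some j.
Proof.
move=> pn; rewrite /first_index; case: pselect => [h|[]]; last by exists n.
by exists (ex_minn h).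
Qed.

(** Between m and the first later time n above the record height at m no time is
    a record, since the height at m is not exceeded there. *)
Lemma next_record m n w : record_at m w ->
  first_index (fun j => (m < j)%N && (height m w < - S_ j w)) = Some n ->
  record_at n w /\ record_count n w = (record_count m w).+1.
Proof.
move=> rm /first_indexP[/andP[mn hmn] nmin].
have hn : height n w = - S_ n w by case: n mn {hmn nmin}.
have low j : (m < j < n)%N -> height j w <= height m w.
  move=> /andP[mj jn]; rewrite leNgt; apply/negP => hj.
  have hj' : height m w < - S_ j w by case: (j) mj hj.
  by have := nmin j; rewrite mj hj' => /(_ isT); rewrite leqNgt jn.
have rn : record_at n w.
  move=> j jn; rewrite hn; apply: le_lt_trans hmn.
  case: (ltngtP j m) => [jm|mj|->//]; first by rewrite ltW// rm.
  by apply: low; rewrite mj.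
split => //.
have cnt i : (m + i < n)%N -> record_count (m + i).+1 w = (record_count m w).+1.
  elim: i => [|i IH] min; first by rewrite addn0 record_countS asboolT ?addn1.
  rewrite addnS record_countS IH; last by lia.
  rewrite asboolF ?addn0// => /(_ m); rewrite -addnS => h.
  have := low (m + i.+1)%N; rewrite leNgt h; first by move=> /(_ _)/negP; apply; lia.
  by lia.
have := cnt (n - m).-1; rewrite (_ : (m + (n - m).-1).+1 = n); last by lia.
by apply; lia.
Qed.

(** Together with [record_ladder], identifies the recursively defined ladder
    process with an explicit event, which shows that it is measurable and allows
    summing over ladder epochs in any order. *)
Lemma ladder_record k w n h : ladder w k = Some (n, h) ->
  [/\ record_at n w, record_count n w = k & h = height n w].
Proof.
elim: k n h => [|k IH] n h /=.
  by move=> [<- <-]; split => //; rewrite /record_count big_ord0.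
case E : (ladder w k) => [[m g]|//]; have [rm cm ->] := IH _ _ E.
case F : (first_index _) => [j|//] /= [<- <-].
have [rj ->] := next_record rm F; rewrite cm; split => //.
by have [/andP[+ _] _] := first_indexP F; case: j {F rj}.
Qed.

Lemma record_ladder k w n : record_at n w -> record_count n w = k ->
  ladder w k = Some (n, height n w).
Proof.
elim: k n => [|k IH] n rn cn /=.
  case: n rn cn => // n rn cn.
  have := @record_count_lt 0 n.+1 w; rewrite cn ltn0 => h.
  by have : false by apply: h.
have [|m [mn rm cm]] := @exists_record n k w; first by rewrite cn.
rewrite (IH m)//.
set p : pred nat := (fun j => (m < j)%N && _).
have pn : p n.
  by move: (rn m mn); rewrite /p mn; case: (n) mn.
have [j E] := first_index_exists pn; rewrite E /=.
have [_ /(_ n pn)] := first_indexP E.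
have [rj cj] := next_record rm E.
rewrite leq_eqVlt => /orP[/eqP <-|jn].
  by have [/andP[+ _] _] := first_indexP E; case: j {E rj cj}.
by have := record_count_lt rj jn; rewrite cj cm cn ltnn.
Qed.

Lemma measurable_height n : measurable_fun setT (height n).
Proof.
case: n => [|n]; first exact: measurable_cst.
exact: (measurableT_comp (@oppr_measurable R setT) (@measurable_S R n.+1)).
Qed.

Lemma measurable_record_at n : measurable (record_at n).
Proof.
rewrite (_ : record_at n = \bigcap_(j in [set j | (j < n)%N])
    [set w | height j w < height n w]) //.
by apply: bigcap_measurableType => j _; apply: measurable_lt; exact: measurable_height.
Qed.

Lemma measurable_record_count n k : measurable [set w | record_count n w = k].
Proof.
elim: n k => [|n IH] k.
  rewrite (_ : [set _ | _] = [set w | 0%N = k]); last first.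
    by apply/seteqP; split=> w /=; rewrite /record_count big_ord0.
  have [->|k0] := eqVneq 0%N k.
    by rewrite (_ : [set _ | _] = setT)//; apply/seteqP; split.
  rewrite (_ : [set _ | _] = set0)//; apply/seteqP; split=> // w /= h.
  by move: k0; rewrite h eqxx.
rewrite (_ : [set _ | _] =
  (record_at n `&` [set w | (record_count n w).+1 = k]) `|`
  (~` record_at n `&` [set w | record_count n w = k])); last first.
  apply/seteqP; split=> w /=; rewrite record_countS.
    by case: asboolP => r; rewrite ?addn1 ?addn0 => <-; [left|right].
  by case=> -[r <-]; [rewrite asboolT// addn1|rewrite asboolF// addn0].
have mr := measurable_record_at n.
apply: measurableU; apply: measurableI => //; last exact: measurableC.
case: k => [|k]; first by rewrite (_ : [set _ | _] = set0)//; apply/seteqP; split.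
rewrite (_ : [set _ | _] = [set w | record_count n w = k])//.
by apply/seteqP; split=> w /=; [case|move=> ->].
Qed.

Lemma measurable_height_le n (y : R) : measurable [set w | height n w <= y].
Proof. by apply: measurable_le => //; exact: measurable_height. Qed.

Lemma trivIset_record k : trivIset setT
  (fun n => record_at n `&` [set w | record_count n w = k]).
Proof.
apply/trivIsetP => i j _ _ ij; apply/seteqP; split => // w [[ri ci] [rj cj]].
case: (ltngtP i j) ij => // [l|l] _.
  by have := record_count_lt ri l; rewrite ci cj ltnn.
by have := record_count_lt rj l; rewrite ci cj ltnn.
Qed.

Lemma ladder_height_le k (y : R) :
  [set w | (ladder_height k w <= y%:E)%E] =
  \bigcup_n (record_at n `&` [set w | record_count n w = k] `&`
             [set w | height n w <= y]).
Proof.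
apply/seteqP; split=> w /=; rewrite /ladder_height.
  case E : (ladder w k) => [[n h]|]; last by rewrite leye_eq.
  by have [rn cn ->] := ladder_record E; rewrite lee_fin => hy; exists n.
by move=> [n _ [[rn cn] hy]]; rewrite (record_ladder rn cn) lee_fin.
Qed.

Lemma measurable_ladder_height_le k (y : R) :
  measurable [set w | (ladder_height k w <= y%:E)%E].
Proof.
rewrite ladder_height_le; apply: bigcup_measurable => n _.
apply: measurableI (measurable_height_le _ _).
by apply: measurableI; [exact: measurable_record_at|exact: measurable_record_count].
Qed.

(** Double count of the ladder heights below y: by rank in the definition of the
    renewal function, by epoch here. *)
Lemma renewal_records (P0 : probability (Omega_RW R) R) (y : R) :
  renewal P0 y =
  (\sum_(0 <= n <oo) P0 (record_at n `&` [set w | height n w <= y]%R))%E.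
Proof.
pose A n k := record_at n `&` [set w | record_count n w = k] `&`
             [set w | height n w <= y].
have mA n k : measurable (A n k).
  apply: measurableI (measurable_height_le _ _).
  by apply: measurableI; [exact: measurable_record_at|exact: measurable_record_count].
rewrite /renewal.
transitivity (\sum_(0 <= k <oo) \sum_(0 <= n <oo) P0 (A n k))%E.
  apply: eq_eseriesr => k _; rewrite ladder_height_le.
  apply: measure_semi_bigcup.
  - by move=> n; exact: mA n k.
  - have /trivIsetP t := @trivIset_record k.
    apply/trivIsetP => i j _ _ /(t _ _ Logic.I Logic.I) t0.
    by apply/seteqP; split => // w [[a _] [b _]]; rewrite -t0.
  - by apply: bigcup_measurable => n _; exact: mA n k.
rewrite nneseries_interchange//; apply: eq_eseriesr => n _.
rewrite -measure_semi_bigcup//; first 1 last.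
- apply/trivIsetP => i j _ _ ij; apply/seteqP; split => // w [[[_ /= a] _] [[_ /= b] _]].
  by move: ij; rewrite -a -b eqxx.
- exact: bigcup_measurable.
congr (P0 _); apply/seteqP; split=> w.
  by move=> [k _ [[]]].
by move=> [rn hy]; exists (record_count n w).
Qed.

Lemma renewal_strict_min (P0 : probability (Omega_RW R) R) (y : R) :
  P0 [set w | S_ 0 w = 0] = 1%E ->
  renewal P0 y =
  (\sum_(0 <= n <oo) P0 (strict_min n `&` [set w | - y <= w n]%R))%E.
Proof.
move=> P00; rewrite renewal_records; apply: eq_eseriesr => n _.
have m0 : measurable [set w : Omega_RW R | S_ 0 w = 0].
  by apply: measurable_eq => //; exact: measurable_S.
rewrite -(probability_setI1 _ m0 P00); last first.
  by apply: measurableI (measurable_height_le _ _); exact: measurable_record_at.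
rewrite -[in RHS](probability_setI1 _ m0 P00); last first.
  exact: measurable_strict_min_ge.
congr (P0 _); apply/seteqP; split=> w [[h hy] /= w0]; split => //.
all: have hE j : height j w = - w j by case: j => //=; rewrite -[w 0%N]/(S_ 0 w) w0 oppr0.
  split; first by move=> j /h; rewrite !hE ltrN2.
  by move: hy; rewrite /= hE lerNl.
split; first by move=> j /h; rewrite !hE ltrN2.
by rewrite /= hE lerNl.
Qed.

End ladder_process.


(** * Decomposition of the conditioned walk at its minimum *)

Section renewal_function.
Variables (R : realType) (P0 : probability (Omega_RW R) R).

Lemma renewal_ge0 y : (0 <= renewal P0 y)%E.
Proof. exact: nneseries_ge0. Qed.

Lemma probability_ladder_height_mono k : {homo (fun y =>
  P0 [set w | (ladder_height k w <= y%:E)%E]) : y z / y <= z >-> (y <= z)%E}.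
Proof.
move=> y z yz; apply: le_measure; rewrite ?inE; try exact: measurable_ladder_height_le.
by move=> w /= /le_trans; apply; rewrite lee_fin.
Qed.

Lemma renewal_mono y z : y <= z -> (renewal P0 y <= renewal P0 z)%E.
Proof. by move=> yz; apply: lee_nneseries => // k _; exact: probability_ladder_height_mono. Qed.

Lemma measurable_renewal : measurable_fun setT (renewal P0).
Proof.
apply: ge0_emeasurable_sum => // k _.
rewrite (_ : (fun y => _) = (fun y =>
    (fine (P0 [set w | (ladder_height k w <= y%:E)%E]))%:E)); last first.
  apply/funext => y; rewrite fine_probability//.
  exact: measurable_ladder_height_le.
apply/measurable_EFinP; apply: nondecreasing_measurable => // y z yz.
rewrite -lee_fin !fine_probability; try exact: measurable_ladder_height_le.
exact: probability_ladder_height_mono.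
Qed.

(** A strict minimum at a time n > 0 of a path from 0 is negative, so only the
    epoch 0 contributes. *)
Lemma renewal0 : P0 [set w | S_ 0 w = 0] = 1%E -> renewal P0 0 = 1%E.
Proof.
move=> P00.
have m0 : measurable [set w : Omega_RW R | S_ 0 w = 0].
  by apply: measurable_eq => //; exact: measurable_S.
have mS n := @measurable_strict_min_ge R n (- 0).
rewrite renewal_strict_min// nneseries_recl// eseries0 ?adde0; last first.
  case=> // n _ _; rewrite -(probability_setI1 _ m0 P00)//.
  rewrite [X in P0 X](_ : _ = set0) ?measure0//.
  apply/seteqP; split=> // w [[h hn] w0] /=; have := h 0%N isT.
  by rewrite -[w 0%N]/(S_ 0 w) w0 ltNge -[0](@oppr0 R) hn.
rewrite -(probability_setI1 _ m0 P00)// -P00; congr (P0 _).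
by apply/seteqP; split=> w [] //= w0; split => //; split=> //=; rewrite oppr0 -[w 0%N]/(S_ 0 w) w0.
Qed.

End renewal_function.

Section series.
Variable R : realType.

(** With term n singled out, the other terms of the two series compare termwise;
    finiteness allows cancelling them, which bounds b n by a n. *)
Lemma eseries_eq_of_le (a b : nat -> \bar R) : (forall n, 0 <= a n)%E ->
  (forall n, a n <= b n)%E -> (\sum_(0 <= n <oo) a n < +oo)%E ->
  (\sum_(0 <= n <oo) b n <= \sum_(0 <= n <oo) a n)%E -> forall n, a n = b n.
Proof.
move=> a0 ab aoo ba n; apply/eqP; rewrite eq_le ab /=.
have b0 k : (0 <= b k)%E := le_trans (a0 k) (ab k).
move: aoo ba; rewrite (@nneseriesD1 _ a n)// (@nneseriesD1 _ b n)//.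
set x := (\sum_(0 <= k <oo | _) a k)%E; set z := (\sum_(0 <= k <oo | _) b k)%E.
have xz : (x <= z)%E by apply: lee_nneseries.
have x0 : (0 <= x)%E by apply: nneseries_ge0.
move=> aoo; have xfin : x \is a fin_num.
  by rewrite ge0_fin_numE// (le_lt_trans _ aoo)// leeDr.
move=> h; have := le_trans (leeD2l (b n) xz) h.
by rewrite leeD2rE.
Qed.

End series.

Section minimum_decomposition.
Variables (R : realType) (nu : probability R R).
Variables (P Pplus : R -> probability (Omega_RW R) R).
Hypothesis walkP : forall x, is_random_walk nu x (P x).
Hypothesis walkPplus : forall y, 0 <= y -> is_conditioned_walk P y (Pplus y).

Let V := renewal (P 0).

Let measurable_start y : measurable [set w : Omega_RW R | S_ 0 w = y].
Proof. by apply: measurable_eq => //; exact: measurable_S. Qed.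

Let P_start y : P y [set w | S_ 0 w = y] = 1%E.
Proof. by have [] := walkP y. Qed.

Let Pplus_start y : 0 <= y -> Pplus y [set w | S_ 0 w = y] = 1%E.
Proof. by move=> /walkPplus[]. Qed.

(** Were V y infinite, the normalization of the conditioned law would give it
    total mass 0. *)
Lemma renewal_fin_num y : 0 <= y -> V y \is a fin_num.
Proof.
move=> y0; rewrite ge0_fin_numE ?renewal_ge0// ltey; apply/eqP => Vy.
have [_ /(_ 1%N setT isT)] := walkPplus y0.
rewrite probability_setT -/V Vy invey mul0e => H.
have /H/eqP : sigma_S 1 [set: Omega_RW R].
  exact: (@measurableT _ (coord_space R [set n | (1 <= n <= 1)%N])).
by rewrite eqe oner_eq0.
Qed.

Lemma renewal_ge1 y : 0 <= y -> (1 <= V y)%E.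
Proof. by move=> y0; rewrite -(renewal0 (P_start 0)) renewal_mono. Qed.

Lemma fine_renewal_gt0 y : 0 <= y -> 0 < fine (V y).
Proof.
move=> y0; rewrite fine_gt0// (lt_le_trans _ (renewal_ge1 y0))//=.
by rewrite ltey_eq renewal_fin_num.
Qed.

Lemma inve_renewal y : 0 <= y -> ((V y)^-1 = (fine (V y))^-1%:E)%E.
Proof.
move=> y0; rewrite -[in LHS](fineK (renewal_fin_num y0)) inver.
by rewrite gt_eqF// fine_renewal_gt0.
Qed.

Let measurable_VS n : measurable_fun setT (fun w : Omega_RW R => V (S_ n w)).
Proof. exact: (measurableT_comp (measurable_renewal (P 0)) (@measurable_S R n)). Qed.

(** Extends the defining formula of the conditioned walk to events that also
    involve the starting point, which is almost surely y under both laws. *)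
Lemma conditioned_history y M (B : set (Omega_RW R)) : 0 <= y -> (0 < M)%N ->
  history M B ->
  Pplus y B = ((V y)^-1 * \int[P y]_(w in B `&` @stays_nonneg R M) V (S_ M w))%E.
Proof.
move=> y0 M0 hB.
(* Replacing the starting point by y turns an event of the history into one that
   depends on the times 1, ..., M only. *)
pose start (w : Omega_RW R) : Omega_RW R := fun n => if n is 0 then y else w n.
set I := [set n | (1 <= n <= M)%N].
have mstart : measurable_fun setT (start : coord_space R I -> coord_space R (past M)).
  apply: measurable_to_coord => -[|j] jM; first exact: measurable_cst.
  by apply: measurable_coord; rewrite /I/=.
set B' := start @^-1` B.
have sB' : sigma_S M B'.
  by have := mstart measurableT _ hB; rewrite setTI.
have mB := measurable_history hB.
have mB' : measurable B' by exact: measurable_history (history_sigma_S sB').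
have mstays : measurable (@stays_nonneg R M).
  exact: measurable_history (@history_stays_nonneg R M).
have startE (w : Omega_RW R) : S_ 0 w = y -> start w = w.
  by move=> wy; apply/funext => -[|n].
have BB' D : B `&` D `&` [set w | S_ 0 w = y] = B' `&` D `&` [set w | S_ 0 w = y].
  apply/seteqP; split=> w [[Bw Dw] wy]; split => //; split => //; move: Bw.
    by rewrite /B' /= startE.
  by rewrite /B' /= startE.
have := BB' setT; rewrite !setIT => BB'T.
rewrite -(probability_setI1 mB (measurable_start y) (Pplus_start y0)) BB'T.
rewrite (probability_setI1 mB' (measurable_start y) (Pplus_start y0)).
have [_ /(_ M _ M0 sB') ->] := walkPplus y0; congr (_ * _)%E.
have intE D : measurable D -> (\int[P y]_(w in D) V (S_ M w) =
    \int[P y]_(w in D `&` [set w | S_ 0 w = y]) V (S_ M w))%E.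
  move=> mD; rewrite -[X in _ `&` X]setCK -setDE.
  apply: ge0_negligible_integral => //.
  - exact: measurableC.
  - exact: measurable_funTS.
  - by move=> w _; exact: renewal_ge0.
  - exact: probability_setC0.
have mBs : measurable (B `&` @stays_nonneg R M) by exact: measurableI.
have mBs' : measurable (B' `&` @stays_nonneg R M) by exact: measurableI.
by rewrite (intE _ mBs) (intE _ mBs') BB'.
Qed.

(** Restarting at time 0 translates the walk from y to the walk from 0. *)
Lemma walk_strict_min y z n :
  P y (strict_min n `&` [set w | z <= w n]) =
  P 0 (strict_min n `&` [set w | - (y - z) <= w n]).
Proof.
have mC := @measurable_strict_min_ge R n z.
have := restart_independent (walkP y) (walkP 0) (k := 0) (A := setT)
  (@measurableT _ (coord_space R (past 0)))
  (@measurable_strict_min_ge R n (- (y - z))).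
rewrite probability_setT mul1e setTI => <-.
rewrite -(probability_setI1 mC (measurable_start y) (P_start y)).
rewrite -[in RHS](probability_setI1 _ (measurable_start y) (P_start y)); last first.
  by apply: measurable_preimage_restart; exact: measurable_strict_min_ge.
congr (P y _); apply/seteqP; split=> w [[h hn] /= wy]; split => //; move: wy.
all: rewrite /S_ => wy.
  split=> [j jn|]; first by rewrite /restart ltrD2r; exact: h.
  by move: hn; rewrite /= /restart wy add0n; lra.
split=> [j jn|]; first by have := h j jn; rewrite /restart ltrD2r.
by move: hn; rewrite /= /restart wy add0n; lra.
Qed.

Lemma series_walk_strict_min y z :
  (\sum_(0 <= n <oo) P y (strict_min n `&` [set w | z <= w n]%R) = V (y - z)%R)%E.
Proof.
rewrite /V (renewal_strict_min _ (P_start 0)); apply: eq_eseriesr => n _.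
exact: walk_strict_min.
Qed.

(** The mass that the product formula assigns to the event A before the
    minimum, when the minimum is at time k. *)
Definition weight y k (A : set (Omega_RW R)) : \bar R :=
  ((V y)^-1 * P y (A `&` nonneg_strict_min k))%E.

Lemma ge0_weight y k A : (0 <= weight y k A)%E.
Proof. by rewrite mule_ge0// inve_ge0 renewal_ge0. Qed.

Lemma weight_fin_num y k A : 0 <= y -> measurable A -> weight y k A \is a fin_num.
Proof.
move=> y0 mA; rewrite /weight inve_renewal// fin_numM// fin_num_measure//.
apply: measurableI => //; exact: measurable_history (@history_nonneg_strict_min R k).
Qed.

Lemma series_weight y : 0 <= y -> (\sum_(0 <= k <oo) weight y k setT = 1)%E.
Proof.
move=> y0.
transitivity ((V y)^-1 * \sum_(0 <= k <oo) P y (nonneg_strict_min k))%E.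
  rewrite inve_renewal// -nneseriesZl//; apply: eq_eseriesr => k _.
  by rewrite /weight inve_renewal// setTI.
rewrite series_walk_strict_min subr0 mulVe ?renewal_fin_num//.
by rewrite gt_eqF// (lt_le_trans _ (renewal_ge1 y0)).
Qed.

(** On the event the walk is nonnegative at time k, so by monotonicity the factor
    V (S_(k+M)) is at least V evaluated at the restarted path, which is
    independent of the history up to k. *)
Lemma weight_le y k M (A C : set (Omega_RW R)) : 0 <= y -> (0 < M)%N ->
  history k A -> history M C ->
  (weight y k A * Pplus 0 C <=
   Pplus y (A `&` nonneg_strict_min k `&` restart k @^-1` (C `&` @stays_nonneg R M)))%E.
Proof.
move=> y0 M0 hA hC.
set CM := C `&` @stays_nonneg R M.
have hCM : history M CM.
  apply: (@measurableI _ (coord_space R (past M))) => //.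
  exact: history_stays_nonneg.
have hAL : history k (A `&` nonneg_strict_min k).
  apply: (@measurableI _ (coord_space R (past k))) => //.
  exact: history_nonneg_strict_min.
set E := A `&` nonneg_strict_min k `&` _.
have hE : history (k + M) E.
  apply: (@measurableI _ (coord_space R (past (k + M)))); last exact: history_restart.
  exact: history_mono (leq_addr _ _) hAL.
have mE := measurable_history hE.
have kM : (0 < k + M)%N by rewrite addn_gt0 M0 orbT.
rewrite (conditioned_history _ kM hE)// (conditioned_history _ M0 hC)//.
rewrite -/CM [V 0](renewal0 (P_start 0)) inve1 mul1e /weight -muleA.
apply: lee_wpmul2l; first by rewrite inve_ge0 renewal_ge0.
(* The constraint to stay nonnegative up to k + M is implied: before k the path
   is above w k >= 0, after k it is above w k by the constraint on the restarted
   path. *)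
have stayE : E `&` @stays_nonneg R (k + M) = E.
  apply/seteqP; split=> w; first by case.
  move=> Ew; split => //; case: Ew => [[_ [lw /= wk]] [_ sw]] n /andP[n0 nkM].
  case: (leqP n k) => [nk|kn].
    move: nk; rewrite leq_eqVlt => /orP[/eqP -> //|/lw/ltW].
    exact: le_trans.
  have := sw (n - k)%N; rewrite /S_ /restart subnKC ?(ltnW kn)// => h.
  by apply: (le_trans wk); rewrite -subr_ge0; apply: h; lia.
rewrite stayE.
rewrite -(restart_independent_integral (f := fun w => V (S_ M w))
  (walkP y) (walkP 0) hAL (measurable_history hCM)); first last.
- by move=> w; exact: renewal_ge0.
- exact: measurable_funTS.
apply: ge0_le_integral => //.
- by move=> w _; exact: renewal_ge0.
- apply: measurable_funTS.
  apply: (measurableT_comp (measurable_VS M)); exact: measurable_restart.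
- exact: measurable_funTS.
- move=> w [[_ [_ /= wk]] _]; apply: renewal_mono.
  by rewrite /S_ /restart gerBl.
Qed.

Definition stays_nonneg_forever : set (Omega_RW R) :=
  \bigcap_M @stays_nonneg R M.

Definition min_at k : set (Omega_RW R) :=
  nonneg_strict_min k `&` restart k @^-1` stays_nonneg_forever.

Lemma measurable_stays_nonneg_forever : measurable stays_nonneg_forever.
Proof.
apply: bigcapT_measurable => M; exact: measurable_history (@history_stays_nonneg R M).
Qed.

Lemma measurable_min_at k : measurable (min_at k).
Proof.
apply: measurableI; first exact: measurable_history (@history_nonneg_strict_min R k).
apply: measurable_preimage_restart; exact: measurable_stays_nonneg_forever.
Qed.

(** The event is that k is the first time of the overall minimum and that this
    minimum is nonnegative. *)
Lemma min_atE k (w : Omega_RW R) : min_at k w <->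
  [/\ 0 <= w k, forall j, (j < k)%N -> w k < w j & forall j, w k <= w j].
Proof.
split=> [[[lw wk] sw]|[wk lw low]].
  split=> // j; case: (ltngtP j k) => [/lw/ltW //|kj|-> //].
  have := sw j Logic.I (j - k)%N; rewrite /S_ /restart subnKC ?(ltnW kj)//.
  by rewrite subr_ge0; apply; lia.
split; first by split.
by move=> M _ n _; rewrite /S_ /restart subr_ge0.
Qed.

Lemma trivIset_min_at : trivIset setT min_at.
Proof.
apply/trivIsetP => i j _ _ ij; apply/seteqP; split => // w.
move=> [/min_atE[_ li lowi] /min_atE[_ lj lowj]] /=.
case: (ltngtP i j) ij => // [/lj|/li] + _.
  by rewrite ltNge lowi.
by rewrite ltNge lowj.
Qed.

(** Limit of [weight_le] as the horizon M of the nonnegativity constraint grows: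
    the left hand side does not depend on M. *)
Lemma weight_le_min_at y k m (A C : set (Omega_RW R)) : 0 <= y ->
  history k A -> history m C ->
  (weight y k A * Pplus 0 C <= Pplus y (A `&` min_at k `&` restart k @^-1` C))%E.
Proof.
move=> y0 hA hC.
have mA := measurable_history hA; have mC := measurable_history hC.
pose F M := A `&` nonneg_strict_min k `&` restart k @^-1` (C `&` @stays_nonneg R M).
have mF M : measurable (F M).
  apply: measurableI.
    apply: measurableI => //; exact: measurable_history (@history_nonneg_strict_min R k).
  apply: measurable_preimage_restart; apply: measurableI => //.
  exact: measurable_history (@history_stays_nonneg R M).
have ndF : {homo F : n m / (n <= m)%N >-> (m <= n)%O}.
  move=> M M' MM'; apply/subsetPset => w [ALw [Cw sw]]; split => //; split => //.
  by move=> n /andP[n0 nM]; apply: sw; rewrite n0 (leq_trans nM).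
have FE : \bigcap_M F M = A `&` min_at k `&` restart k @^-1` C.
  apply/seteqP; split=> w.
    move=> h; have [[Aw Lw] [Cw _]] := h 0%N Logic.I.
    by split => //; split => //; split => // M _; have [_ []] := h M Logic.I.
  by move=> [[Aw [Lw sw]] Cw] M _; split => //; split => //; exact: sw.
have mbF : measurable (\bigcap_M F M) by exact: bigcapT_measurable.
have cvgF : (Pplus y \o F) M @[M --> \oo] --> Pplus y (\bigcap_M F M).
  apply: nonincreasing_cvg_mu => //.
  by rewrite (le_lt_trans (probability_le1 _ _)) ?ltry.
rewrite -FE -(cvg_lim _ cvgF)//; apply: lime_ge; first by apply/cvg_ex; eexists; exact: cvgF.
near=> M; apply: weight_le => //; first by near: M; exact: nbhs_infty_gt.
by apply: history_mono hC; near: M; exact: nbhs_infty_ge.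
Unshelve. all: by end_near. Qed.

(** The weights have total mass one and the events are disjoint, so the
    inequalities of [weight_le_min_at] leave no room. *)
Lemma Pplus_min_at y k : 0 <= y -> weight y k setT = Pplus y (min_at k).
Proof.
move=> y0; move: k; apply: eseries_eq_of_le => [k|k||].
- exact: ge0_weight.
- have := @weight_le_min_at y k 0 setT setT y0 (@measurableT _ (coord_space R (past k)))
    (@measurableT _ (coord_space R (past 0))).
  by rewrite probability_setT mule1 setTI preimage_setT setIT.
- by rewrite series_weight ?ltry.
- rewrite series_weight// -measure_semi_bigcup//.
  + by apply: probability_le1; apply: bigcup_measurable => k _; exact: measurable_min_at.
  + exact: measurable_min_at.
  + exact: trivIset_min_at.
  + by apply: bigcup_measurable => k _; exact: measurable_min_at.
Qed.

Lemma Pplus_split_min y (D : set (Omega_RW R)) : 0 <= y -> measurable D ->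
  Pplus y D = (\sum_(0 <= k <oo) Pplus y (D `&` min_at k))%E.
Proof.
move=> y0 mD.
have mU : measurable (\bigcup_k min_at k).
  by apply: bigcup_measurable => k _; exact: measurable_min_at.
have U1 : Pplus y (\bigcup_k min_at k) = 1%E.
  rewrite measure_semi_bigcup//; first last.
  - exact: trivIset_min_at.
  - exact: measurable_min_at.
  rewrite -(series_weight y0); apply: eq_eseriesr => k _.
  by rewrite Pplus_min_at.
rewrite -(probability_setI1 mD mU U1) setI_bigcupr measure_semi_bigcup//.
- by move=> k; apply: measurableI => //; exact: measurable_min_at.
- exact: trivIset_setIl trivIset_min_at.
- by apply: bigcup_measurable => k _; apply: measurableI => //; exact: measurable_min_at.
Qed.

(** The inequality also holds for (A, ~` C) and (~` A, setT); the three add up to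
    the equality of [Pplus_min_at], so each of them is an equality. *)
Lemma Pplus_min_at_history y k m (A C : set (Omega_RW R)) : 0 <= y ->
  history k A -> history m C ->
  Pplus y (A `&` min_at k `&` restart k @^-1` C) = (weight y k A * Pplus 0 C)%E.
Proof.
move=> y0 hA hC; apply/eqP; rewrite eq_le (weight_le_min_at y0 hA hC) andbT.
have mA := measurable_history hA; have mC := measurable_history hC.
have mk := measurable_min_at k.
have mL := measurable_history (@history_nonneg_strict_min R k).
have hAc : history k (~` A) by exact: (@measurableC _ (coord_space R (past k))).
have hCc : history m (~` C) by exact: (@measurableC _ (coord_space R (past m))).
have mr := measurable_preimage_restart k mC.
have le1 := weight_le_min_at y0 hA hCc.
have le2 := weight_le_min_at y0 hAc (@measurableT _ (coord_space R (past 0))).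
rewrite probability_setT mule1 preimage_setT setIT in le2.
have mAk : measurable (A `&` min_at k) by exact: measurableI.
have eqP1 : (Pplus y (A `&` min_at k) =
   Pplus y (A `&` min_at k `&` restart k @^-1` C) +
   Pplus y (A `&` min_at k `&` restart k @^-1` (~` C)))%E.
  by rewrite [LHS](measureDI (Pplus y) mAk mr) [LHS]addeC setDE preimage_setC.
have eqP2 : (Pplus y (min_at k) = Pplus y (A `&` min_at k) + Pplus y (~` A `&` min_at k))%E.
  by rewrite [LHS](measureDI (Pplus y) mk mA) [LHS]addeC setDE ![min_at k `&` _]setIC.
have eqW : (weight y k setT = weight y k A + weight y k (~` A))%E.
  rewrite /weight -ge0_muleDr// setTI [in LHS](measureDI (P y) mL mA) [X in (_ * X)%E]addeC setDE.
  by rewrite ![nonneg_strict_min k `&` _]setIC.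
have eqC : (weight y k A = weight y k A * Pplus 0 C + weight y k A * Pplus 0 (~` C))%E.
  by rewrite -ge0_muleDr// probability_setC// addeC subeK ?mule1// fin_num_measure.
have total := Pplus_min_at k y0; rewrite eqW eqC eqP2 eqP1 in total.
have fw B : measurable B -> weight y k B \is a fin_num by exact: weight_fin_num.
have fp x B : measurable B -> Pplus x B \is a fin_num by exact: fin_num_measure.
move: le1 le2 total.
have mCc := measurable_history hCc; have mAc := measurable_history hAc.
have mrc := measurable_preimage_restart k mCc.
rewrite -(fineK (fw _ mA)) -(fineK (fw _ mAc)) -(fineK (fp 0 _ mC)) -(fineK (fp 0 _ mCc)).
rewrite -(fineK (fp y _ (measurableI _ _ mAk mr))) -(fineK (fp y _ (measurableI _ _ mAk mrc))).
rewrite -(fineK (fp y _ (measurableI _ _ mAc mk))).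
rewrite -!EFinM -!EFinD !lee_fin => le1 le2 [].
lra.
Qed.

Lemma Pplus_min_at_restart y k (A C : set (Omega_RW R)) : 0 <= y ->
  history k A -> measurable C ->
  Pplus y (A `&` min_at k `&` restart k @^-1` C) = (weight y k A * Pplus 0 C)%E.
Proof.
move=> y0 hA mC.
have mAk : measurable (A `&` min_at k).
  by apply: measurableI; [exact: measurable_history hA|exact: measurable_min_at].
have wE m (B : set (Omega_RW R)) : history m B ->
    Pplus y (A `&` min_at k `&` restart k @^-1` B) =
    (Pplus y (A `&` min_at k) * Pplus 0 B)%E.
  move=> hB; rewrite (Pplus_min_at_history y0 hA hB); congr (_ * _)%E.
  have := Pplus_min_at_history y0 hA (@measurableT _ (coord_space R (past 0))).
  by rewrite preimage_setT setIT probability_setT mule1.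
have [m [mE _]] := restart_measure (Pplus y) k mAk.
have wT := Pplus_min_at_history y0 hA (@measurableT _ (coord_space R (past 0))).
rewrite preimage_setT setIT probability_setT mule1 in wT.
rewrite -wT -(mscale_probabilityE (Pplus y) (Pplus 0) _ mAk) -mE.
apply: measure_eq_history mC => [|n B hB].
  by rewrite mE preimage_setT setIT (le_lt_trans (probability_le1 _ _)) ?ltry.
by rewrite mE /= mscale_probabilityE//; exact: wE hB.
Qed.

End minimum_decomposition.


(** * The minimum of the rescaled path *)

Section rescaled_path.
Variables (R : realType) (a : nat -> R) (N : nat).
Hypotheses (aN : 0 < a N) (N0 : (0 < N)%N).

Let NR : 0 < N%:R :> R. Proof. by rewrite ltr0n. Qed.

Lemma X_phi t (w : Omega_RW R) :
  X_ t (phi a N w) = w (Num.truncn (N%:R * t)) / a N.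
Proof. by []. Qed.

Lemma X_phi_grid n (w : Omega_RW R) : X_ (n%:R / N%:R) (phi a N w) = w n / a N.
Proof. by rewrite X_phi [N%:R * _]mulrC divfK ?gt_eqF// natrK. Qed.

(** The rescaled path is a step function taking its values at grid points. *)
Lemma infX_phi (w : Omega_RW R) :
  infX (phi a N w) = inf (range (fun n => w n / a N)).
Proof.
congr inf; apply/seteqP; split=> _ [t t0 <-].
  by exists (Num.truncn (N%:R * t)).
by exists (t%:R / N%:R); [rewrite /= divr_ge0|exact: X_phi_grid].
Qed.

Lemma measurable_scaled_coord n :
  measurable_fun setT (fun w : Omega_RW R => w n / a N).
Proof. exact: (measurableT_comp (mulrr_measurable (a N)^-1) (@measurable_S R n)). Qed.

(** Paths that are unbounded below need a separate treatment, as [inf] is 0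
    there. *)
Lemma measurable_infX_phi_ge z : measurable [set w | z <= infX (phi a N w)].
Proof.
pose bnd : set (Omega_RW R) := \bigcup_m \bigcap_n [set w | - m%:R <= w n / a N].
have bndP (w : Omega_RW R) : bnd w <-> has_lbound (range (fun n => w n / a N)).
  split=> [[m _ h]|[r hr]].
    by exists (- m%:R) => _ [n _ <-]; exact: h.
  exists (Num.truncn `|r|).+1 => // n _ /=.
  apply: (le_trans _ (hr _ _)); last by exists n.
  rewrite lerNl (le_trans (ler_norm _))// normrN ltW//.
  by have /andP[] := truncn_itv (normr_ge0 r).
have mbnd : measurable bnd.
  apply: bigcup_measurable => m _; apply: bigcapT_measurable => n.
  by apply: measurable_le => //; exact: measurable_scaled_coord.
rewrite (_ : [set w | _] =
  (bnd `&` \bigcap_n [set w : Omega_RW R | z <= w n / a N]) `|`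
  (~` bnd `&` [set w | z <= 0])).
  apply: measurableU; apply: measurableI => //.
  - apply: bigcapT_measurable => n.
    by apply: measurable_le => //; exact: measurable_scaled_coord.
  - exact: measurableC.
  - by apply: measurable_le.
have ne (w : Omega_RW R) : range (fun n => w n / a N) !=set0 by exists (w 0%N / a N), 0%N.
apply/seteqP; split=> w /=; rewrite infX_phi.
  case: (pselect (bnd w)) => bw zw; [left|right]; split => //.
    move=> n _ /=; apply: (le_trans zw); apply: ge_inf; last by exists n.
    exact/bndP.
  by move: zw; rewrite inf_out// => -[_ /bndP].
move=> [[bw h]|[bw z0]].
  by apply: lb_le_inf => // _ [n _ <-]; exact: h.
by rewrite inf_out// => -[_ /bndP].
Qed.

Lemma measurable_infX_phi : measurable_fun setT (fun w => infX (phi a N w)).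
Proof.
apply: (measurability (@RGenCInfty.G R)); first exact: RGenCInfty.measurableE.
move=> _ [_ [z ->] <-]; rewrite setTI.
rewrite (_ : _ @^-1` _ = [set w | z <= infX (phi a N w)]).
  exact: measurable_infX_phi_ge.
by apply/seteqP; split=> w /=; rewrite in_itv/= andbT.
Qed.

(** The default value 0 matches the value of [argmin_time] on paths that do not
    attain their infimum. *)
Definition argmin_index (w : Omega_RW R) : nat :=
  if first_index (fun n => w n / a N == infX (phi a N w)) is Some n then n else 0%N.

Lemma argmin_time_phi (w : Omega_RW R) :
  argmin_time (phi a N w) = (argmin_index w)%:R / N%:R.
Proof.
rewrite /argmin_time /argmin_index.
set p : pred nat := (fun n : nat => _ == _); set T := [set t | _].
have pT t : T t -> p (Num.truncn (N%:R * t)).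
  by move=> [_ h]; rewrite /p -h X_phi.
case E : (first_index p) => [n|].
  have [pn nmin] := first_indexP E.
  have Tn : T (n%:R / N%:R).
    by split; [rewrite divr_ge0|rewrite X_phi_grid; exact/eqP].
  have lbT : lbound T (n%:R / N%:R).
    move=> t Tt; rewrite ler_pdivrMr// mulrC.
    apply: (@le_trans _ _ (Num.truncn (N%:R * t))%:R).
      by rewrite ler_nat nmin// pT.
    have /truncn_itv/andP[//] : 0 <= N%:R * t by case: Tt => t0 _; rewrite mulr_ge0// ltW.
  apply/le_anti/andP; split; first by apply: ge_inf => //; exists (n%:R / N%:R).
  by apply: lb_le_inf => //; exists (n%:R / N%:R).
rewrite (_ : T = set0) ?inf0 ?mul0r//.
apply/seteqP; split=> // t /pT /first_index_exists[j]; by rewrite E.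
Qed.

Lemma measurable_argmin_index n : measurable [set w | argmin_index w = n].
Proof.
pose p n : set (Omega_RW R) := [set w | w n / a N = infX (phi a N w)].
have mp j : measurable (p j).
  by apply: measurable_eq; [exact: measurable_scaled_coord|exact: measurable_infX_phi].
have mfirst m : measurable [set w : Omega_RW R |
    first_index (fun n => w n / a N == infX (phi a N w)) = Some m].
  rewrite (_ : [set w | _] = p m `&` \bigcap_(j in [set j | (j < m)%N]) ~` p j).
    by apply: measurableI => //; apply: bigcap_measurableType => j _; exact: measurableC.
  apply/seteqP; split=> w /=.
    move=> /first_indexP[/eqP pm mmin]; split => // j /= jm /eqP pj.
    by have := mmin j pj; rewrite leqNgt jm.
  move=> [pm mmin].
  have [j E] := first_index_exists (p := fun n => w n / a N == infX (phi a N w))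
    (introT eqP pm).
  have [/eqP pj jmin] := first_indexP E; rewrite E; congr Some.
  apply/eqP; rewrite eqn_leq jmin ?(introT eqP pm)//= leqNgt; apply/negP => jm.
  exact: (mmin j jm).
case: n => [|n]; last first.
  rewrite (_ : [set w | _] = [set w : Omega_RW R |
    first_index (fun n => w n / a N == infX (phi a N w)) = Some n.+1])//.
  apply/seteqP; split=> w /=; rewrite /argmin_index; last by move=> ->.
  by case: (first_index _) => // j <-.
rewrite (_ : [set w | _] = ~` \bigcup_n [set w : Omega_RW R |
    first_index (fun n => w n / a N == infX (phi a N w)) = Some n.+1]).
  by apply/measurableC/bigcup_measurable => j _.
apply/seteqP; split=> w /=; rewrite /argmin_index.
  by case E : (first_index _) => [j|] => [j0|_] [i _] /=; rewrite E // j0.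
case E : (first_index _) => [[|j]|] // h.
by exfalso; apply: h; exists j.
Qed.

Lemma infX_phi_min_at k (w : Omega_RW R) : min_at k w -> infX (phi a N w) = w k / a N.
Proof.
move=> /min_atE[_ _ kmin]; rewrite infX_phi.
have kinf : lbound (range (fun n => w n / a N)) (w k / a N).
  by move=> _ [n _ <-]; rewrite ler_pM2r ?invr_gt0.
apply/le_anti/andP; split.
  by apply: ge_inf; [exists (w k / a N)|exists k].
by apply: lb_le_inf => //; exists (w k / a N), k.
Qed.

Lemma argmin_index_min_at k (w : Omega_RW R) : min_at k w -> argmin_index w = k.
Proof.
move=> mk; rewrite /argmin_index (infX_phi_min_at mk).
have /min_atE[_ lk _] := mk.
have [j E] := first_index_exists (p := fun n => w n / a N == w k / a N) (eqxx _).
rewrite E; have [/eqP + jmin] := first_indexP E.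
move=> /(congr1 ( *%R^~ (a N))); rewrite !divfK ?gt_eqF// => wjk.
have := jmin k (eqxx _); rewrite leq_eqVlt => /orP[/eqP //|/lk].
by rewrite wjk ltxx.
Qed.

(** The time of the minimum is a multiple of the mesh 1 / N, so shifting by it
    shifts the index by an integer. *)
Lemma X_post_min_phi t (w : Omega_RW R) : 0 <= t ->
  X_ t (post_min (phi a N w)) =
  w (argmin_index w + Num.truncn (N%:R * t))%N / a N - infX (phi a N w).
Proof.
move=> t0; rewrite /X_ /= /affine_fun !mul1r (max_idPl t0) argmin_time_phi.
rewrite -[Defs.path _ _]/(X_ _ (phi a N w)) X_phi; congr (w _ / _ - _).
rewrite mulrDr [X in _ + X]mulrC divfK ?gt_eqF// addrC truncnD ?natrK//.
by rewrite qualifE /= mulr_ge0// ltW.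
Qed.

Lemma measurable_post_min_phi :
  measurable_fun setT (@post_min R \o phi a N).
Proof.
apply: (@measurability _ _ _ _ setT (@post_min R \o phi a N) (@cadlag_sets R)) => //.
move=> _ [_ [t t0 [B mB <-]] <-]; rewrite !setTI.
rewrite (_ : _ @^-1` _ = \bigcup_k ([set w | argmin_index w = k] `&`
  (fun w : Omega_RW R => w (k + Num.truncn (N%:R * t))%N / a N - infX (phi a N w)) @^-1` B)).
  apply: bigcup_measurable => k _; apply: measurableI; first exact: measurable_argmin_index.
  rewrite -[X in measurable X]setTI; apply: measurable_funB => //.
    exact: measurable_scaled_coord.
  exact: measurable_infX_phi.
apply/seteqP; split=> w;
  rewrite /preimage /= -[affine_fun _ _ _ _ _ t]/(X_ t (post_min (phi a N w)));
  rewrite X_post_min_phi//.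
  by exists (argmin_index w).
by move=> [k _ [<-]].
Qed.

Lemma cadlag_path_ext (f g : cadlag_path R) :
  (forall t, 0 <= t -> f t = g t) -> f = g.
Proof.
move=> fg.
have : Defs.path f = Defs.path g.
  apply/funext => t; have [t0|t0] := leP 0 t; first exact: fg.
  by rewrite path_neg// fg// [in RHS]path_neg.
case: f g {fg} => f cf nf [g cg ng] /= E; subst g.
by congr CadlagPath; exact: Prop_irrelevance.
Qed.

Lemma post_min_phi_min_at k (w : Omega_RW R) : min_at k w ->
  post_min (phi a N w) = phi a N (restart k w).
Proof.
move=> mk; apply: cadlag_path_ext => t t0.
rewrite -[LHS]/(X_ t _) -[RHS]/(X_ t _) X_post_min_phi// (argmin_index_min_at mk).
by rewrite (infX_phi_min_at mk) X_phi /restart mulrBl.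
Qed.

Lemma measurable_preimage_phi (B : set (Omega R)) : measurable B ->
  measurable (phi a N @^-1` B).
Proof. by move=> mB; rewrite -[X in measurable X]setTI; exact: measurable_phi. Qed.

Lemma measurable_preimage_post_min_phi (B : set (Omega R)) : measurable B ->
  measurable (phi a N @^-1` (@post_min R @^-1` B)).
Proof.
by move=> mB; rewrite -[X in measurable X]setTI; exact: measurable_post_min_phi.
Qed.

(** Events that, on each set where the minimum is at k, are determined by the path
    up to k. *)
Definition past_of_min (E : set (Omega_RW R)) : Prop :=
  measurable E /\
  forall k, exists2 A, history k A & E `&` min_at k = A `&` min_at k.

(** Such events form a sigma-algebra.  A generator asks that t be at most the time
    of the minimum and constrains the position at t: when the minimum is at k
    this is empty if k / N < t, and otherwise involves an index at most k. *)
Lemma past_of_min_pre_min_sigma (A : set (Omega R)) : pre_min_sigma A ->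
  past_of_min (phi a N @^-1` A).
Proof.
move: A; apply: smallest_sub => [|_ [t [B [t0 mB ->]]]].
  split.
  - split; first by rewrite preimage_set0.
    move=> k; exists set0; last by rewrite preimage_set0.
    exact: (@measurable0 _ (coord_space R (past k))).
  - move=> A [mA tA]; split; first by rewrite setTD preimage_setC; exact: measurableC.
    move=> k; have [A' hA' AA'] := tA k; exists (~` A').
      exact: (@measurableC _ (coord_space R (past k))).
    have /seteqP[s1 s2] := AA'.
    apply/seteqP; split=> w [nA mw]; split => //; rewrite setTD in nA *.
      by move=> A'w; apply: nA; have [] := s2 w (conj A'w mw).
    by move=> Aw; apply: nA; have [] := s1 w (conj Aw mw).
  - move=> A hA; split.
      by rewrite preimage_bigcup; apply: bigcup_measurable => n _; case: (hA n).
    move=> k; have /choice[A' hA'] : forall n, exists A', history k A' /\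
        phi a N @^-1` A n `&` min_at k = A' `&` min_at k.
      by move=> n; have [_ /(_ k)[A' h1 h2]] := hA n; exists A'.
    exists (\bigcup_n A' n).
      by apply: (@bigcup_measurable _ (coord_space R (past k))) => n _; case: (hA' n).
    by rewrite preimage_bigcup !setI_bigcupl; apply: eq_bigcupr => n _; case: (hA' n).
set m := Num.truncn (N%:R * t).
have mk k : t <= k%:R / N%:R -> (m <= k)%N.
  move=> tk; rewrite -(ler_nat R).
  have /truncn_itv/andP[+ _] : 0 <= N%:R * t by rewrite mulr_ge0.
  by move=> /le_trans; apply; rewrite mulrC -ler_pdivlMr.
have hB k : (m <= k)%N -> history k ((fun w : Omega_RW R => w m / a N) @^-1` B).
  move=> lemk; rewrite /history -[X in measurable X]setTI.
  apply: (measurableT_comp (mulrr_measurable (a N)^-1)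
    (@measurable_coord R (past k) m lemk)) => //.
have preE : phi a N @^-1` [set w | t <= argmin_time w /\ B (X_ t w)] =
    [set w | t <= (argmin_index w)%:R / N%:R] `&` (fun w : Omega_RW R => w m / a N) @^-1` B.
  by apply/seteqP; split=> w /=; rewrite argmin_time_phi.
rewrite preE; split.
  apply: measurableI; last exact: measurable_history (hB m (leqnn m)).
  rewrite (_ : [set w | _] = \bigcup_(k in [set k | t <= k%:R / N%:R])
    [set w | argmin_index w = k]).
    by apply: bigcup_measurable => k _; exact: measurable_argmin_index.
  apply/seteqP; split=> w /=; first by exists (argmin_index w).
  by move=> [k /= tk ->].
move=> k; have [tk|kt] := leP t (k%:R / N%:R).
  exists ((fun w : Omega_RW R => w m / a N) @^-1` B); first exact: hB (mk _ tk).
  apply/seteqP; split=> w; first by move=> [[_ ?] ?].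
  by move=> [Bw minw]; split => //; split => //=; rewrite (argmin_index_min_at minw).
exists set0; first exact: (@measurable0 _ (coord_space R (past k))).
rewrite set0I; apply/seteqP; split=> // w [[/= + _] /argmin_index_min_at kw].
by rewrite kw leNgt kt.
Qed.

End rescaled_path.

Section post_minimum.
Variables (R : realType) (nu : probability R R).
Variables (P Pplus : R -> probability (Omega_RW R) R).
Hypothesis walkP : forall x, is_random_walk nu x (P x).
Hypothesis walkPplus : forall y, 0 <= y -> is_conditioned_walk P y (Pplus y).
Variables (a : nat -> R) (N : nat).
Hypotheses (aN : 0 < a N) (N0 : (0 < N)%N).

Lemma Pplus_past_of_min y (E : set (Omega_RW R)) (A : nat -> set (Omega_RW R)) :
  0 <= y -> measurable E ->
  (forall k, history k (A k) /\ E `&` min_at k = A k `&` min_at k) ->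
  Pplus y E = (\sum_(0 <= k <oo) weight P y k (A k))%E.
Proof.
move=> y0 mE EA; rewrite (Pplus_split_min walkP walkPplus y0 mE).
apply: eq_eseriesr => k _; have [hA ->] := EA k.
have := Pplus_min_at_restart walkP walkPplus y0 hA measurableT.
by rewrite preimage_setT setIT probability_setT mule1.
Qed.

(** Sum of the product formula over the time of the minimum, where on each piece
    the post-minimum path is the rescaled restarted path. *)
Lemma Pplus_post_min y (E : set (Omega_RW R)) (B : set (Omega R)) :
  0 <= y -> past_of_min E -> measurable B ->
  Pplus y (E `&` phi a N @^-1` (@post_min R @^-1` B)) =
  (Pplus y E * Pplus 0 (phi a N @^-1` B))%E.
Proof.
move=> y0 [mE tE] mB.
have /choice[A hA] : forall k, exists A, history k A /\ E `&` min_at k = A `&` min_at k.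
  by move=> k; have [A' h1 h2] := tE k; exists A'.
have mphiB := @measurable_preimage_phi R a N _ mB.
have mpost : measurable (phi a N @^-1` (@post_min R @^-1` B)).
  exact: measurable_preimage_post_min_phi.
rewrite (Pplus_past_of_min y0 mE hA).
rewrite (Pplus_split_min walkP walkPplus y0); last exact: measurableI.
rewrite muleC -(fine_probability (Pplus 0) mphiB) -nneseriesZl; last first.
  by move=> k _; exact: ge0_weight.
apply: eq_eseriesr => k _; have [hAk EAk] := hA k.
rewrite muleC fine_probability// -(Pplus_min_at_restart walkP walkPplus y0 hAk mphiB).
rewrite setIAC EAk; congr (Pplus y _).
by apply/seteqP; split=> w [[Aw mw] Bw]; split => //; move: Bw;
  rewrite /preimage /= (post_min_phi_min_at aN N0 mw).
Qed.

Lemma past_of_minT : @past_of_min R setT.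
Proof.
split; first exact: measurableT.
by move=> k; exists setT => //; exact: (@measurableT _ (coord_space R (past k))).
Qed.

Lemma Pplus_post_min_law y (B : set (Omega R)) : 0 <= y -> measurable B ->
  Pplus y (phi a N @^-1` (@post_min R @^-1` B)) = Pplus 0 (phi a N @^-1` B).
Proof.
move=> y0 mB; have := Pplus_post_min y0 past_of_minT mB.
by rewrite setTI probability_setT mul1e.
Qed.

(** Sum of the weights of the events w k >= a N * z; as z >= 0, the constraint
    w k >= 0 is absorbed and [series_walk_strict_min] applies. *)
Lemma Pplus_infX y z : 0 <= y -> 0 <= z ->
  Pplus y [set w | z <= infX (phi a N w)] =
  ((renewal (P 0) y)^-1 * renewal (P 0) (y - a N * z)%R)%E.
Proof.
move=> y0 z0.
rewrite (Pplus_past_of_min (A := fun k => [set w | a N * z <= w k]) y0); last 2 first.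
- exact: measurable_infX_phi_ge.
- move=> k; split; first exact: history_level.
  apply/seteqP; split=> w [/= h mw]; split => //; move: h.
    by rewrite (infX_phi_min_at aN N0 mw) ler_pdivlMr// mulrC.
  by rewrite /= (infX_phi_min_at aN N0 mw) ler_pdivlMr// mulrC.
rewrite -(series_walk_strict_min walkP) (inve_renewal walkP walkPplus y0).
rewrite -nneseriesZl//; apply: eq_eseriesr => k _.
rewrite /weight (inve_renewal walkP walkPplus y0); congr (_ * P y _)%E.
apply/seteqP; split=> w [] /=; first by move=> h [].
move=> lw h; split => //; split => //=; apply: le_trans h.
by rewrite mulr_ge0// ltW.
Qed.

(** The conditioned law from 0 charges only paths that stay nonnegative and has
    total mass one. *)
Lemma stays_nonneg_gt0 : (0 < P 0 (@stays_nonneg R N))%E.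
Proof.
rewrite lt0e measure_ge0 andbT; apply/eqP => stay0.
have := conditioned_history walkP walkPplus (lexx 0) N0
  (@measurableT _ (coord_space R (past N))).
rewrite probability_setT setTI null_set_integral//.
- by rewrite mule0 => /eqP; rewrite eqe oner_eq0.
- exact: measurable_history (@history_stays_nonneg R N).
- apply: measurable_funTS.
  exact: (measurableT_comp (measurable_renewal (P 0)) (@measurable_S R N)).
Qed.

Lemma VN_ratio x z : 0 <= z <= x ->
  (VN (P 0) a N (x - z)%R / VN (P 0) a N x =
   (renewal (P 0) (a N * x)%R)^-1 * renewal (P 0) (a N * x - a N * z)%R)%E.
Proof.
move=> /andP[z0 zx].
have y0 : 0 <= a N * x by rewrite mulr_ge0 ?(ltW aN)// (le_trans z0).
have yz0 : 0 <= a N * x - a N * z by rewrite -mulrBr mulr_ge0 ?(ltW aN)// subr_ge0.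
rewrite /VN mulrBr (inve_renewal walkP walkPplus y0).
have mstay := measurable_history (@history_stays_nonneg R N).
have := stays_nonneg_gt0; rewrite -(fine_probability (P 0) mstay) lte_fin.
set p := fine (P 0 _) => p0.
have v0 := fine_renewal_gt0 walkP walkPplus y0.
rewrite -(fineK (renewal_fin_num walkPplus y0)) -(fineK (renewal_fin_num walkPplus yz0)).
rewrite -!EFinM inver gt_eqF ?mulr_gt0// -!EFinM; congr EFin.
by field; rewrite !gt_eqF.
Qed.

End post_minimum.

(** * The three assertions *)

Theorem lemma4p1 (R : realType) (nu : probability R R)
    (P Pplus : R -> probability (Omega_RW R) R) (a : nat -> R)
    (alpha rho : R) (Q : probability (Omega R) R)
    (walkP : forall x, is_random_walk nu x (P x))
    (walkPplus : forall y, 0 <= y -> is_conditioned_walk P y (Pplus y))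
    (a_gt0 : forall n, 0 < a n)
    (stableQ : is_stable_levy alpha rho Q)
    (rho01 : 0 < rho < 1)
    (cvgS : cvg_in_law (P 0) (fun n w => S_ n w / a n) Q (X_ 1))
    (N : nat) (x : R) (N_gt0 : (0 < N)%N) (x_ge0 : 0 <= x) :
  [/\ (forall A : set (Omega R), measurable A ->
         pushforward (PplusN Pplus a N x) (@post_min R) A =
         PplusN Pplus a N 0 A),
      (forall z : R, 0 <= z <= x ->
         PplusN Pplus a N x [set w | z <= infX w] =
         (VN (P 0%R) a N (x - z)%R / VN (P 0%R) a N x)%E) &
      (forall A B : set (Omega R), @pre_min_sigma R A -> measurable B ->
         PplusN Pplus a N x (A `&` @post_min R @^-1` B) =
         (PplusN Pplus a N x A * PplusN Pplus a N x (@post_min R @^-1` B))%E)].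
Proof.
have aN := a_gt0 N.
have y0 : 0 <= a N * x by rewrite mulr_ge0// ltW.
have postE A : measurable A -> PplusN Pplus a N x (@post_min R @^-1` A) =
    PplusN Pplus a N 0 A.
  move=> mA; rewrite -[RHS]/(Pplus (a N * 0) (phi a N @^-1` A)) mulr0.
  exact: (Pplus_post_min_law walkP walkPplus aN N_gt0 y0 mA).
split=> [A mA|z zx|A B preA mB].
- exact: postE.
- rewrite (VN_ratio walkP walkPplus aN N_gt0 zx).
  by apply: (Pplus_infX walkP walkPplus aN N_gt0 y0); case/andP: zx.
- rewrite postE// -[X in (_ * X)%E]/(Pplus (a N * 0) (phi a N @^-1` B)) mulr0.
  apply: (Pplus_post_min walkP walkPplus aN N_gt0 y0 _ mB).
  exact: past_of_min_pre_min_sigma.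
Qed.
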